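(* The Determinant Conjecture holds for all LEF-groups; moreover, there exist countable non-amenable simple groups for which the Determinant Conjecture holds, and there exist finitely generated groups which are not residually amenable for which the Determinant Conjecture holds.
   Context: LEF-groups are the limit groups of finite marked groups. Here a marked group $(\Gamma,S)$ is a group with an ordered generating system $S=\{s_1,\dots,s_m\}$, $\Sigma_m$ is the set of marked groups with $m$ generators with the metric $d_{\Sigma_m}((\Gamma,S),(\Gamma',S'))=2^{-R}$ if the two groups have exactly the same relations of length at most $R$ with respect to their marked generators, while some relation of length $R+1$ holds in only one of them; a LEF-group is a group which, with some ordered generating system of some size $m$, is a limit in $\Sigma_m$ of finite marked groups. A group is residually amenable if every non-identity element has non-trivial image in some amenable quotient. Determinant Conjecture for a countable group $\Gamma$: for every $d\ge1$ and every positive self-adjoint $\Delta\in\mathrm{Mat}_{d\times d}(\mathbb Z\Gamma)$, $\ln\det_{\mathcal N}(\Delta)\ge0$. Here $\Delta$ is viewed in $\mathrm{Mat}_{d\times d}(N\Gamma)$ acting on $[\ell^2(\Gamma)]^d$, where $N\Gamma$ is the group von Neumann algebra with its usual trace $\mathrm{Tr}_\Gamma$, extended by $\mathrm{Tr}_\Gamma(A)=\sum_{i=1}^d\mathrm{Tr}_\Gamma(a_{ii})$; $F_\Delta(\lambda)=\mathrm{Tr}_\Gamma\,\chi_{[0,\lambda]}(\Delta)$; and $\ln\det_{\mathcal N}(\Delta)=\int_{0^+}^\infty\ln(\lambda)\,dF_\Delta(\lambda)$ if the integral converges, $-\infty$ otherwise. *)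

(* Defs.v *)
From HB Require Import structures.
From mathcomp Require Import all_boot all_order all_fingroup all_algebra finmap.
From mathcomp Require Import all_classical all_reals all_analysis.
From mathcomp Require Import complex.

Set Implicit Arguments.
Unset Strict Implicit.
Unset Printing Implicit Defensive.

Import Order.TTheory GRing.Theory Num.Theory.
Import numFieldNormedType.Exports.

Local Open Scope classical_set_scope.
Local Open Scope ring_scope.

(* A letter (i, true) stands for s_i and (i, false) for its inverse.  Words need
   not be reduced: reduction does not increase length, so two marked groups have
   the same relations of length at most n whichever kind of word is used. *)
Definition word (m : nat) : Type := seq ('I_m * bool).

Section MarkedGroups.
Variable m : nat.

Definition word_eval (G : groupType) (s : 'I_m -> G) (w : word m) : G :=
  (\prod_(l <- w) (if l.2 then s l.1 else (s l.1)^-1))%g.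

Definition generates (G : groupType) (s : 'I_m -> G) : Prop :=
  forall g : G, exists w : word m, word_eval s w = g.

Definition same_relations (n : nat) (G H : groupType)
    (s : 'I_m -> G) (t : 'I_m -> H) : Prop :=
  forall w : word m, (size w <= n)%N ->
    (word_eval s w = 1%g <-> word_eval t w = 1%g).

(* At most one n satisfies the condition; if none does, all relations coincide
   and the distance is 0. *)
Definition marked_dist (R : realType) (G H : groupType)
    (s : 'I_m -> G) (t : 'I_m -> H) : R :=
  if pselect (exists n, same_relations n s t /\ ~ same_relations n.+1 s t)
    is left e then 2 ^- projT1 (cid e) else 0.

End MarkedGroups.

Definition finitely_generated (G : groupType) : Prop :=
  exists (m : nat) (s : 'I_m -> G), generates s.

Definition lef_group (R : realType) (G : groupType) : Prop :=
  exists (m : nat) (s : 'I_m -> G), generates s /\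
  exists (H : nat -> finGroupType) (t : forall n, 'I_m -> H n),
    (forall n, generates (t n)) /\
    marked_dist R s (t n) @[n --> \oo] --> (0 : R).

Definition simple_group (G : groupType) : Prop :=
  (exists g : G, g <> 1%g) /\
  forall N : set G,
    N 1%g ->
    (forall g h, N g -> N h -> N (g * h)%g) ->
    (forall g, N g -> N (g^-1)%g) ->
    (forall g h, N g -> N (g ^ h)%g) ->
    N = [set 1%g] \/ N = setT.

(* Amenability through a finitely additive left-invariant probability measure
   defined on all subsets. *)
Definition amenable (R : realType) (G : groupType) : Prop :=
  exists mu : set G -> R,
    [/\ mu setT = 1,
        forall A, 0 <= mu A,
        forall A B, A `&` B = set0 -> mu (A `|` B) = mu A + mu B &
        forall g A, mu [set (g * h)%g | h in A] = mu A].

Definition residually_amenable (R : realType) (G : groupType) : Prop :=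
  forall g : G, g <> 1%g ->
  exists (Q : groupType) (f : {multiplicative G -> Q}),
    [/\ amenable R Q, forall q, exists h, f h = q & f g <> 1%g].

Section SquareSummable.
Variables (R : realType) (T : choiceType).
Implicit Types x y : T -> R[i].

Definition real_sum (f : T -> R) : R :=
  fine (\esum_(t in setT) (EFin \o f)^\+ t)%E -
  fine (\esum_(t in setT) (EFin \o f)^\- t)%E.

Definition complex_sum x : R[i] :=
  (real_sum (fun t => complex.Re (x t)) +i* real_sum (fun t => complex.Im (x t)))%C.

Definition l2norm2 x : \bar R :=
  (\esum_(t in setT) (complex.Re (x t) ^+ 2 + complex.Im (x t) ^+ 2)%:E)%E.

Definition ell2 : set (T -> R[i]) := [set x | (l2norm2 x < +oo)%E].

Definition l2dot x y : R[i] := complex_sum (fun t => x t * conjc (y t)).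

End SquareSummable.

Section GroupVonNeumannAlgebra.
Variables (R : realType) (G : groupType).

Local Notation C := R[i].
Local Notation vec := (G -> C).

(* Operators on l^2(G) are functions on G -> C; only their restriction to
   l^2(G) is meaningful. *)
Definition bounded_op (a : vec -> vec) : Prop :=
  (forall (c : C) (x y : vec), ell2 x -> ell2 y ->
     a (fun g => c * x g + y g) = (fun g => c * a x g + a y g)) /\
  (exists M : R, forall x, ell2 x -> (l2norm2 (a x) <= M%:E * l2norm2 x)%E).

(* N(G) acts on the left: it is the algebra of bounded operators commuting with
   the right translations. *)
Definition group_vN (a : vec -> vec) : Prop :=
  bounded_op a /\
  forall (k : G) (x : vec), ell2 x ->
    a (fun g => x (g * k)%g) = (fun g => a x (g * k)%g).

Definition unit_vec : vec := fun g => (g == 1%g)%:R.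

Definition vN_trace (a : vec -> vec) : C := l2dot (a unit_vec) unit_vec.

Definition group_ring : Type := {fsfun G -> int with 0}.

Definition left_conv (a : group_ring) : vec -> vec :=
  fun x g => \sum_(h <- finsupp a) (a h)%:~R * x (h^-1 * g)%g.

Section Matrices.
Variable d : nat.

(* Vectors in l^2(G)^d. *)
Local Notation dvec := ('I_d -> G -> C).
Local Notation dop := 'M[vec -> vec]_d.

Definition ell2d : set dvec := [set x | forall i, ell2 (x i)].

Definition dotd (x y : dvec) : C := \sum_i l2dot (x i) (y i).

Definition mx_act (A : dop) (x : dvec) : dvec :=
  fun i g => \sum_j A i j (x j) g.

Definition mx_vN (A : dop) : Prop := forall i j, group_vN (A i j).

Definition mx_trace (A : dop) : C := \sum_i vN_trace (A i i).

Definition self_adjoint (A : dop) : Prop :=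
  forall x y, ell2d x -> ell2d y -> dotd (mx_act A x) y = dotd x (mx_act A y).

(* 0 <= z for z complex means that z is real and nonnegative. *)
Definition positive_op (A : dop) : Prop :=
  forall x, ell2d x -> 0 <= dotd (mx_act A x) x.

(* E is the projection-valued spectral measure of A, i.e. E(B) = chi_B(A) for
   every Borel set B: each A^n is the integral of t^n against E.  The values
   of E on non-Borel sets are irrelevant. *)
Definition is_spectral_measure (A : dop) (E : set R -> dop) : Prop :=
  [/\ forall B, measurable B -> mx_vN (E B) /\ self_adjoint (E B),
      forall x, ell2d x -> mx_act (E setT) x = x,
      forall B1 B2 x, measurable B1 -> measurable B2 -> ell2d x ->
        mx_act (E (B1 `&` B2)) x = mx_act (E B1) (mx_act (E B2) x) &
      forall x, ell2d x ->
        exists mu : {measure set (measurableTypeR R) -> \bar R},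
          (forall B, measurable B ->
             mu B = (complex.Re (dotd (mx_act (E B) x) x))%:E) /\
          (forall n : nat,
             (\int[mu]_t (t ^+ n)%:E)%E =
             (complex.Re (dotd (iter n (mx_act A) x) x))%:E)].

(* Every self-adjoint A in Mat_d(N(G)) has a spectral measure (spectral
   theorem), unique up to the values on non-Borel sets and outside l^2(G); the
   default value of xget only serves to make the function total. *)
Definition spectral_measure (A : dop) : set R -> dop :=
  xget (fun=> const_mx (fun _ _ => 0)) (is_spectral_measure A).

Definition spectral_distribution (A : dop) (lambda : R) : R :=
  complex.Re (mx_trace (spectral_measure A `[0, lambda])).

End Matrices.
End GroupVonNeumannAlgebra.

(* The measure dF; for F the spectral distribution of a positive operator, F is
   nondecreasing and right-continuous. *)
Definition stieltjes (R : realType) (F : R -> R) :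
    set (measurableTypeR R) -> \bar R :=
  if pselect (exists f : cumulative R R, (f : R -> R) = F) is left e
  then lebesgue_stieltjes_measure (projT1 (cid e)) else mzero.

Definition lndet (R : realType) (G : groupType) (d : nat)
    (A : 'M[(G -> R[i]) -> (G -> R[i])]_d) : \bar R :=
  let dF := stieltjes (spectral_distribution A) in
  if dF.-integrable `]0, +oo[ (fun t => (ln t)%:E)
  then (\int[dF]_(t in `]0%R, +oo[) (ln t)%:E)%E
  else -oo%E.

Definition determinant_conjecture (R : realType) (G : groupType) : Prop :=
  forall (d : nat) (Delta : 'M[group_ring G]_d), (0 < d)%N ->
    let A := map_mx (@left_conv R G) Delta in
    self_adjoint A -> positive_op A -> (0 <= lndet A)%E.

(* Main.v *)
(* For a finite group H, an integral symmetric matrix M over Z[H], viewed as a real matrix, has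
   an integral characteristic polynomial, so the product of its nonzero eigenvalues is a nonzero
   integer.  Hence the normalized trace of p(M) is nonnegative for every real polynomial p with
   p(0) >= 0 and p(t) >= ln (t^2) for t <> 0.  If G embeds locally into finite groups, then, up to
   any given degree, the moments of the spectral measure mu of Delta are the normalized traces of
   the powers of such an M, so the integral of p with respect to mu is also nonnegative.  Taking
   for p truncations of the Taylor series of ln c + ln (1 - u), u = 1 - t^2/c, corrected by a
   multiple of a high power of u so as to be nonnegative at 0, one gets in the limit that the
   integral of ln over the positive half-line is nonnegative.

   The simple group is PSL_2(Q), which embeds locally into the groups PSL_2(F_p).  The group that
   is not residually amenable is generated by SL_2(Z), or rather a nonamenable subgroup, and two
   noncommuting lamps at 1 in the wreath product of S_3 with SL_2(Z): it is a limit of wreath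
   products of S_3 with SL_2(Z/n), and a map to an amenable group is not injective on the
   subgroup of SL_2(Z), hence identifies a lamp at 1 with a lamp elsewhere, and hence kills the
   commutator of the two lamps at 1.  Nonamenability is seen on the nonzero vectors (x, y) of the
   plane: the translates of {|x| <= |y|} by (1, 3; 0, 1) and its square are disjoint from it, and
   its image under the rotation by a right angle is its complement up to the diagonals. *)

From HB Require Import structures.
Require Import Defs.
From mathcomp Require Import all_boot all_order all_fingroup all_algebra spectral finmap.
From mathcomp Require Import all_classical all_reals all_analysis measurable_realfun complex.
From mathcomp Require Import ring lra zify.

Set Implicit Arguments.
Unset Strict Implicit.
Unset Printing Implicit Defensive.

Import Order.TTheory GRing.Theory Num.Theory.
Import numFieldNormedType.Exports.

Local Open Scope classical_set_scope.
Local Open Scope ring_scope.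

(** * Traces of integral symmetric matrices *)

Lemma map_mxX_pz (aR rR : pzRingType) (f : {rmorphism aR -> rR}) n
    (M : 'M[aR]_n) k : map_mx f (M ^+ k) = map_mx f M ^+ k.
Proof.
elim: k => [|k IH]; first by rewrite !expr0 -[1]/(1%:M) map_mx1.
by rewrite !exprS -[M * _]/(M *m _) map_mxM IH.
Qed.

Lemma diag_mxX (S : pzRingType) n (d : 'rV[S]_n) k :
  diag_mx d ^+ k = diag_mx (\row_i d 0 i ^+ k).
Proof.
elim: k => [|k IH].
  rewrite expr0 -[1]/(1%:M) -diag_const_mx; congr diag_mx.
  by apply/rowP => i; rewrite !mxE expr0.
rewrite exprS IH -[_ * _]/(_ *m _) mulmx_diag; congr diag_mx.
by apply/rowP => i; rewrite !mxE exprS.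
Qed.

Lemma conj_mxX (F : comUnitRingType) n (P D : 'M[F]_n) k : P \in unitmx ->
  (invmx P *m D *m P) ^+ k = invmx P *m D ^+ k *m P.
Proof.
move=> Pu; elim: k => [|k IH]; first by rewrite !expr0 mulmx1 mulVmx.
by rewrite !exprS IH -![_ * _]/(_ *m _) !mulmxA mulmxK.
Qed.

Section SymmetricSpectrum.
Local Open Scope complex_scope.

(** Over [R[i]] the matrix is Hermitian, hence unitarily diagonalizable with real spectrum [t]. The
    traces of powers and the characteristic polynomial are read off the diagonal form and descend to
    [R] by injectivity. *)
Lemma symmetric_int_mx_spectrum (R : realType) n (M : 'M[int]_n) : M^T = M ->
  exists t : 'I_n -> R,
    (forall k, (\tr (M ^+ k))%:~R = \sum_i t i ^+ k) /\
    map_poly intr (char_poly M) = \prod_i ('X - (t i)%:P).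
Proof.
move=> symM; pose A : 'M[R[i]]_n := map_mx intr M.
have hA : A \is hermsymmx.
  apply/is_hermitianmxP; rewrite expr0 scale1r; apply/matrixP => i j.
  by rewrite !mxE -[in LHS]symM !mxE rmorph_int.
have [t tE] : exists t : 'I_n -> R, forall i, spectral_diag A 0 i = (t i)%:C.
  exists (fun i => complex.Re (spectral_diag A 0 i)) => i.
  have /mxOverP/(_ 0 i) := hermitian_spectral_diag_real hA.
  by move=> /RRe_real ->.
exists t.
have /hermitian_normalmx/orthomx_spectralP AE := hA.
have Pu := spectral_unit A.
set P := spectralmx A in AE Pu; set D := spectral_diag A in AE tE.
have inj : injective (fun x : R => x%:C) by move=> x y [].
split=> [k|].
  apply: inj; rewrite rmorph_int [RHS]rmorph_sum /=.
  transitivity (\tr (A ^+ k)); first by rewrite -map_mxX_pz trace_map_mx.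
  rewrite AE conj_mxX // mxtrace_mulC mulmxA mulmxV // mul1mx diag_mxX mxtrace_diag.
  by apply: eq_bigr => i _; rewrite mxE tE rmorphXn.
apply: (map_inj_poly inj) => //.
rewrite rmorph_prod /= -map_poly_comp /=.
transitivity (map_poly intr (char_poly M) : {poly R[i]}).
  by apply: eq_map_poly => z /=; rewrite rmorph_int.
rewrite map_char_poly -/A.
(* Invariance under conjugation: ['X%:M] is central, hence equal to its own conjugate. *)
have -> : char_poly A = char_poly (diag_mx D).
  set Q := map_mx polyC P.
  have Qu : Q \in unitmx by rewrite map_unitmx.
  rewrite /char_poly /char_poly_mx {1}AE !map_mxM map_invmx -/Q.
  have -> : 'X%:M = invmx Q *m 'X%:M *m Q :> 'M[{poly R[i]}]_n.
    by rewrite mul_mx_scalar -scalemxAl mulVmx // scalemx1.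
  rewrite -mulmxBl -mulmxBr !det_mulmx mulrAC -det_mulmx mulVmx // det1 mul1r.
  by rewrite mul_mx_scalar -scalemxAl mulVmx // scalemx1.
rewrite char_poly_trig ?diag_mx_is_trig //.
by apply: eq_bigr => i _; rewrite mxE eqxx tE rmorphB /= map_polyX map_polyC.
Qed.

End SymmetricSpectrum.

(** The sum is that of [p] over the eigenvalues: zero ones contribute at least 0, the others
    together at least [ln (b ^+ 2)], where [b] is up to sign a nonzero integer, so [b ^+ 2 >= 1]. *)
Lemma symmetric_int_mx_trace_ge0 (R : realType) n (M : 'M[int]_n)
    (p : {poly R}) : M^T = M ->
  0 <= p.[0] -> (forall t : R, t != 0 -> ln (t ^+ 2) <= p.[t]) ->
  0 <= \sum_(k < size p) p`_k * (\tr (M ^+ k))%:~R.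
Proof.
move=> /(@symmetric_int_mx_spectrum R)[t [trE charE]] p0 lnp.
have -> : \sum_(k < size p) p`_k * (\tr (M ^+ k))%:~R = \sum_i p.[t i].
  under eq_bigr => k _ do rewrite trE mulr_sumr.
  by rewrite exchange_big /=; apply: eq_bigr => i _; rewrite horner_coef.
pose b := \prod_(i | t i != 0) t i.
have b0 : b != 0 by rewrite prodf_seq_neq0; apply/allP => i _; apply/implyP.
have b1 : 1 <= b ^+ 2.
  (* With [m] the multiplicity of 0, the characteristic polynomial is [q * 'X^m], so its coefficient
     of index [m] is [q.[0]], which is [b] up to sign. *)
  have [c cE] : exists c : int, `|b| = `|c|%:~R.
    pose q : {poly R} := \prod_(i | t i != 0) ('X - (t i)%:P).
    pose m := #|[pred i | t i == 0]|.
    have qE : map_poly intr (char_poly M) = q * 'X^m.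
      rewrite charE (bigID (fun i => t i != 0)) /=; congr (_ * _).
      under eq_bigr => i /negPn/eqP -> do rewrite subr0.
      rewrite prodr_const; congr (_ ^+ _).
      by apply: eq_card => i; rewrite !inE unfold_in negbK.
    exists (char_poly M)`_m.
    rewrite intr_norm -coef_map /= qE coefMXn ltnn subnn.
    rewrite -horner_coef0 horner_prod !normr_prod; apply: eq_bigr => i _.
    by rewrite hornerXsubC sub0r normrN.
  rewrite -[b ^+ 2]ger0_norm ?sqr_ge0 // normrX exprn_ege1 // cE ler1z.
  by move: b0; rewrite -normr_eq0 cE intr_eq0 -gtz0_ge1 lt_def => ->; rewrite normr_ge0.
have := ln_ge0 b1; move=> /le_trans; apply.
rewrite [leRHS](bigID (fun i => t i != 0)) /=.
rewrite -prodrXl.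
have -> : ln (\prod_(i | t i != 0) t i ^+ 2) = \sum_(i | t i != 0) ln (t i ^+ 2).
  (* Positivity is carried along with the logarithm, because additivity of [ln] requires positive
     factors. *)
  pose K (x y : R) := 0 < x /\ ln x = y.
  suff [] : K (\prod_(i | t i != 0) t i ^+ 2) (\sum_(i | t i != 0) ln (t i ^+ 2)) by [].
  apply: (big_ind2 K); first by split; rewrite ?ln1.
    by move=> x y x' y' [x0 <-] [y0 <-]; split; rewrite ?mulr_gt0 ?lnM.
  by move=> i ti; split; rewrite // exprn_even_gt0.
rewrite -[leLHS]addr0 lerD //; first by apply: ler_sum => i; apply: lnp.
by apply: sumr_ge0 => i /negPn/eqP ->.
Qed.

(** * Polynomial approximation of the logarithm *)

Section LogTaylor.
Variable R : realType.
Implicit Types u x : R.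

(** The Taylor polynomial of degree [n] of [- ln (1 - u)] at 0. *)
Definition ln_taylor n : {poly R} := \sum_(k < n) k.+1%:R^-1 *: 'X^(k.+1).

Lemma deriv_ln_taylor n u : (1 - u) * (deriv (ln_taylor n)).[u] = 1 - u ^+ n.
Proof.
have -> : deriv (ln_taylor n) = \sum_(k < n) 'X^k.
  rewrite raddf_sum; apply: eq_bigr => k _ /=.
  by rewrite derivZ derivXn /= -[X in _ *: X](scaler_nat k.+1) scalerA mulVf ?scale1r // pnatr_eq0.
rewrite horner_sum; under eq_bigr => k _ do rewrite hornerXn.
by rewrite -[RHS]opprB subrX1 -mulNr opprB.
Qed.

(** Cauchy form of the remainder: the mean value theorem is applied to the error [g], whose
    derivative is [v ^+ n / (1 - v)] by the geometric sum. *)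
Lemma ln1B_taylor n u : u < 1 ->
  exists2 x, u <= x <= 0 \/ 0 <= x <= u &
    - ln (1 - u) = (ln_taylor n).[u] + u * x ^+ n / (1 - x).
Proof.
move=> u1.
pose g v := - ln (1 - v) - (ln_taylor n).[v].
have dg (v : R) : v < 1 -> is_derive v 1 g (v ^+ n / (1 - v)).
  move=> v1; rewrite /g.
  have v1' : 0 < 1 - v by rewrite subr_gt0.
  have d2 := is_derive1_ln v1'.
  have d3 : is_derive v 1 (fun v => 1 - v) (-1).
    by apply: is_derive_eq; rewrite add0r mul1r.
  have d4 : is_derive v 1 (@ln R \o (fun v => 1 - v)) ((1 - v)^-1 * -1) :=
    @is_derive1_comp R (@ln R) (fun v => 1 - v) v _ _ d2 d3.
  have d5 := is_derive_poly (ln_taylor n) v.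
  apply: (is_derive_eq (is_deriveB (is_deriveN d4) d5)).
  apply: (mulfI (lt0r_neq0 v1')).
  rewrite mulrBr deriv_ln_taylor mulrN1 opprK mulfV ?lt0r_neq0 //.
  by rewrite mulrC divfK ?lt0r_neq0 // subKr.
have g0 : g 0 = 0.
  by rewrite /g subr0 ln1 oppr0 sub0r horner_coef0 /ln_taylor coef_sum big1 ?oppr0 // => k _;
    rewrite coefZ coefXn mulr0.
have cg (a b : R) : b < 1 -> {within `[a, b], continuous g}.
  move=> b1; apply: derivable_within_continuous => x; rewrite in_itv /= => /andP[_ xb].
  by have [] := dg _ (le_lt_trans xb b1).
have conv x : - ln (1 - u) = (ln_taylor n).[u] + u * x ^+ n / (1 - x) <-> g u =
  x ^+ n / (1 - x) * u.
  rewrite /g (_ : x ^+ n / (1 - x) * u = u * x ^+ n / (1 - x)); last by rewrite mulrC mulrA.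
  by split=> [->|<-]; [rewrite addrC addKr|rewrite addrCA subrr addr0].
case: (leP 0 u) => u0.
  have [|x] := @MVT_segment R g (fun x => x ^+ n / (1 - x)) 0 u u0 _ (cg _ _ u1).
    by move=> x; rewrite in_itv /= => /andP[_ xu]; apply: dg; apply: lt_trans xu u1.
  rewrite in_itv /= => xI; rewrite g0 !subr0 => gE.
  by exists x; [right|apply/conv].
have [|x] := @MVT_segment R g (fun x => x ^+ n / (1 - x)) u 0 (ltW u0) _ (cg _ _ ltr01).
  by move=> x; rewrite in_itv /= => /andP[_ xu]; apply: dg; apply: lt_trans xu ltr01.
rewrite in_itv /= => xI; rewrite g0 !sub0r mulrN => /oppr_inj gE.
by exists x; [left|apply/conv].
Qed.

(** The remainder [u * x ^+ n / (1 - x)] is nonnegative because [u] and [x] do not have opposite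
    signs and [n] is odd. Negative [u] must be covered: they arise from [t] beyond [K] below. *)
Lemma ln1B_taylor_odd n u : odd n -> u < 1 -> (ln_taylor n).[u] <= - ln (1 - u).
Proof.
move=> on u1; have [x xu ->] := ln1B_taylor n u1; rewrite lerDl.
have x1 : x < 1 by case: xu => /andP[? ?]; [exact: le_lt_trans ltr01|exact: le_lt_trans u1].
rewrite divr_ge0 ?subr_ge0 ?(ltW x1) //.
rewrite -[n]odd_double_half on add1n exprS mulrA mulr_ge0 //.
  by case: xu => /andP[? ?]; [apply: mulr_le0 => //; apply: le_trans _ _; eassumption
     | apply: mulr_ge0 => //; apply: le_trans _ _; eassumption].
by rewrite -muln2 mulnC exprM exprn_ge0 // sqr_ge0.
Qed.

Lemma cvg_ln_taylor u : 0 <= u < 1 ->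
  (ln_taylor n).[u] @[n --> \oo] --> - ln (1 - u).
Proof.
move=> /andP[u0 u1].
have E n : `|- ln (1 - u) - (ln_taylor n).[u]| <= (1 - u)^-1 * u ^+ n.
  have [x xu ->] := ln1B_taylor n u1.
  have {xu} /andP[x0 xu] : 0 <= x <= u.
    case: xu => // /andP[ux x0].
    have u0' : u = 0 by apply/eqP; rewrite eq_le u0 (le_trans ux x0).
    by move: ux; rewrite u0' => x0'; apply/andP; split.
  have x1 := le_lt_trans xu u1.
  rewrite addrC addKr ger0_norm; last first.
    by rewrite divr_ge0 ?subr_ge0 ?(ltW x1) // mulr_ge0 ?exprn_ge0.
  rewrite [leRHS]mulrC; apply: ler_pM.
  - by rewrite mulr_ge0 ?exprn_ge0.
  - by rewrite invr_ge0 subr_ge0 ltW.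
  - rewrite -[leRHS]mul1r; apply: ler_pM => //; rewrite ?exprn_ge0 ?(ltW u1) //.
    by rewrite lerXn2r // nnegrE.
  - by rewrite lef_pV2 ?posrE ?subr_gt0 // lerD2l lerN2.
have hu : `|u| < 1 by rewrite ger0_norm.
have /cvgr0_norm_le h := cvg_geometric (1 - u)^-1 hu.
apply/cvgrPdist_le => e e0; have := h e e0; apply: filterS => n /=.
by rewrite /geometric /= => /(le_trans (ler_norm _)); apply: le_trans.
Qed.
End LogTaylor.

Lemma ln_taylor_ge0 (R : realType) n (u : R) : 0 <= u -> 0 <= (ln_taylor R n).[u].
Proof.
move=> u0; rewrite horner_sum sumr_ge0 // => k _.
by rewrite hornerZ hornerXn mulr_ge0 ?exprn_ge0 // invr_ge0.
Qed.

Lemma le_ln_taylor (R : realType) n (u v : R) : 0 <= u <= v ->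
  (ln_taylor R n).[u] <= (ln_taylor R n).[v].
Proof.
move=> /andP[u0 uv]; rewrite !horner_sum ler_sum // => k _.
by rewrite !hornerZ !hornerXn ler_wpM2l ?invr_ge0 // lerXn2r // nnegrE // (le_trans u0).
Qed.

Lemma nondecreasing_ln_taylor (R : realType) (u : R) : 0 <= u ->
  nondecreasing_seq (fun n => (ln_taylor R n).[u]).
Proof.
move=> u0; apply/nondecreasing_seqP => n.
rewrite /ln_taylor big_ord_recr /= hornerD lerDl hornerZ hornerXn.
by rewrite mulr_ge0 ?exprn_ge0 // invr_ge0.
Qed.

(** These values are the harmonic numbers. The point [u] satisfies [- ln (1 - u) = M + 1]; the
    values at [u] eventually come within 1 of this and, for [u >= 0], stay below those at 1. *)
Lemma ln_taylor1_unbounded (R : realType) (M : R) :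
  exists n0, forall n, (n0 <= n)%N -> M <= (ln_taylor R n).[1].
Proof.
pose u : R := 1 - expR (- M - 1).
have u1 : u < 1 by rewrite /u ltrBlDr ltrDl expR_gt0.
case: (leP 0 u) => u0; last first.
  exists 0%N => n _; apply: (@le_trans _ _ 0); last exact: ln_taylor_ge0.
  have : 0 < - M - 1 by rewrite -ltr_expR expR0 -subr_lt0.
  lra.
have /cvgrPdist_lt/(_ 1 ltr01)[n0 _ hn] := @cvg_ln_taylor R u (introT andP (conj u0 u1)).
exists n0 => n nn0; apply: (@le_trans _ _ (ln_taylor R n).[u]); last first.
  by apply: le_ln_taylor; rewrite u0 ltW.
have := hn n nn0; rewrite /= /u subKr expRK => /ltr_normlP[_]; lra.
Qed.

(** * Nonnegativity of the logarithmic integral *)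

Section LogIntegral.
Variables (R : realType) (mu : {measure set (measurableTypeR R) -> \bar R}).
Variable K : R.
Hypothesis K1 : 1 <= K.
Hypothesis mu_fin : (mu setT < +oo)%E.
Hypothesis mu_supp : mu (~` `[0, K]) = 0%E.
Hypothesis mu_ln : forall p : {poly R}, 0 <= p.[0] ->
  (forall t : R, t != 0 -> ln (t ^+ 2) <= p.[t]) ->
  (0 <= \int[mu]_t (p.[t])%:E)%E.

(** In the variable [u = 1 - t ^+ 2 / c] one has [ln (t ^+ 2) = ln c + ln (1 - u)] for [t != 0], and
    [[0, K]] corresponds to [[0, 1]]. The harmonic number [H n] is the value of [T n] at 0. *)
Let c := K ^+ 2.
Let U : {poly R} := 1 - c^-1 *: 'X^2.
Let T n : {poly R} := ln_taylor R n \Po U.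
Let H n : R := (ln_taylor R n).[1].

Let c0 : 0 < c. Proof. by rewrite exprn_gt0 // (lt_le_trans ltr01). Qed.

Let UE t : U.[t] = 1 - t ^+ 2 / c.
Proof. by rewrite /U hornerD hornerN hornerZ hornerXn hornerC mulrC. Qed.

Let TE n t : (T n).[t] = (ln_taylor R n).[1 - t ^+ 2 / c].
Proof. by rewrite /T horner_comp UE. Qed.

Let lnE t : t != 0 -> ln (t ^+ 2) = ln c + ln (1 - U.[t]).
Proof.
move=> t0; have t2 : 0 < t ^+ 2 by rewrite exprn_even_gt0.
by rewrite UE subKr -lnM ?posrE ?divr_gt0 // mulrC divfK ?gt_eqF.
Qed.

Let U1 t : t != 0 -> U.[t] < 1.
Proof. by move=> t0; rewrite UE ltrBlDr ltrDl divr_gt0 // exprn_even_gt0. Qed.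

Let U01 t : t \in `[0, K]%R -> 0 <= U.[t] <= 1.
Proof.
rewrite in_itv /= => /andP[t0 tK].
rewrite UE subr_ge0 ler_pdivrMr // mul1r lerBlDr lerDl divr_ge0 ?sqr_ge0 ?(ltW c0) //.
by rewrite andbT lerXn2r // nnegrE (le_trans t0).
Qed.

(* For n odd, N even and ln c <= H n, the polynomial P n N is nonnegative at 0 and at least
   ln (t^2) elsewhere; as N tends to infinity it tends on [0, K] to ln c - T n off 0, and to 0
   at 0. *)
Let P n N : {poly R} := (ln c)%:P - T n + (H n - ln c) *: U ^+ N.

Let PE n N t : (P n N).[t] = ln c - (T n).[t] + (H n - ln c) * U.[t] ^+ N.
Proof. by rewrite /P !hornerE. Qed.

(** At 0 the correction cancels [ln c - H n] exactly. Elsewhere odd [n] gives the bound on [T n],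
    and even [N] keeps the correction nonnegative even where [U] is negative. *)
Let P_int n N : odd n -> ln c <= H n -> ~~ odd N ->
  (0 <= \int[mu]_t ((P n N).[t])%:E)%E.
Proof.
move=> on Hn eN; apply: mu_ln => [|t t0].
  by rewrite PE TE UE expr0n /= mul0r subr0 expr1n mulr1 -/(H n) addrACA; lra.
rewrite PE lnE // -addrA lerD2l.
apply: (@le_trans _ _ (- (T n).[t])); last first.
  by rewrite lerDl mulr_ge0 ?subr_ge0 // exprn_even_ge0.
by rewrite lerNr TE -UE; apply: ln1B_taylor_odd => //; apply: U1.
Qed.

Let D := `[0, K]%classic : set R.
Let D' := `]0, K]%classic : set R.

Let D'D : D' `<=` D.
Proof. by move=> t; rewrite /D /D' /= !in_itv /= => /andP[/ltW -> ->]. Qed.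

Let mD : measurable (D : set (measurableTypeR R)).
Proof. exact: measurable_itv. Qed.

Let mD' : measurable (D' : set (measurableTypeR R)).
Proof. exact: measurable_itv. Qed.

Let measurable_horner (p : {poly R}) :
  measurable_fun (setT : set (measurableTypeR R)) (horner p).
Proof.
apply: continuous_measurable_fun.
exact: continuous_horner.
Qed.

Let mu_D' : (mu D' < +oo)%E.
Proof. by apply: le_lt_trans mu_fin; apply: le_measure; rewrite ?inE. Qed.
Let mu_D : (mu D < +oo)%E.
Proof. by apply: le_lt_trans mu_fin; apply: le_measure; rewrite ?inE. Qed.

Let int_horner (p : {poly R}) A : measurable A -> A `<=` D -> mu.-integrable A (EFin \o horner p).
Proof.
move=> mA AD; apply: (@integrableS _ _ _ mu D) => //.
apply: (@measurable_bounded_integrable _ _ _ mu (horner p) D mD mu_D).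
  exact: measurable_funTS.
have ctsp : {within D, continuous (horner p)}.
  by apply: continuous_subspaceT => x; exact: continuous_horner.
have /compact_bounded[M [_ mrt]] := continuous_compact ctsp (@segment_compact R 0 K).
by exists M; split; rewrite ?num_real // => y yM x xD; apply: mrt => //; exists x.
Qed.

(** Dominated convergence for [P n j.*2]: the powers of [U] tend to 0 on [D'], while each [P n j.*2]
    vanishes at 0, so the limit on [D] is [ln c - T n] restricted to [D']. *)
Let taylor_le n : odd n -> ln c <= H n ->
  (\int[mu]_(t in D') ((T n).[t])%:E <= (ln c)%:E * mu D')%E.
Proof.
move=> on Hn.
pose g : R -> \bar R := (EFin \o horner ((ln c)%:P - T n)).
have PD j : (0 <= \int[mu]_(t in D) (P n j.*2).[t]%:E)%E.
  have := P_int on Hn (negbT (odd_double j)).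
  have DE : D = setT `\` (~` D) by rewrite setTD setCK.
  have -> : (\int[mu]_t ((P n j.*2).[t])%:E = \int[mu]_(t in D) ((P n j.*2).[t])%:E)%E.
    rewrite [in RHS]DE; apply: negligible_integral => //; first exact: measurableC.
    apply/(negligible_integrable (measurableC mD) measurableT _ mu_supp).
      apply/measurable_EFinP; exact: measurable_horner.
    by rewrite -DE; exact: int_horner.
  by [].
have cv : ((\int[mu]_(x in D) ((P n j.*2).[x])%:E)%E @[j --> \oo] -->
    (\int[mu]_(x in D) (g \_ D') x)%E).
  (* The dominating constant: on [D] both [T n] and [H n * U ^+ N] lie between 0 and [H n]. *)
  pose B := ln c + H n + (H n - ln c).
  have lnc0 : 0 <= ln c by rewrite ln_ge0 // exprn_ege1.
  have h := @dominated_convergence _ _ _ mu D mD (fun j =>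
    EFin \o horner (P n j.*2)) (g \_ D') (cst B%:E).
  have {h}[] // := h.
  - by move=> j; apply/measurable_EFinP; exact: measurable_funTS (measurable_horner _).
  - apply: measurable_funTS; apply/(measurable_restrictT g mD')/measurable_EFinP.
    exact: measurable_funTS (measurable_horner _).
  - apply: aeW => t Dt; rewrite patchE; case: ifPn => [/set_mem tD'|].
      have t0 : t != 0 by move: tD'; rewrite /D' /= in_itv /= => /andP[/gt_eqF -> _].
      have /U01/andP[U0 _] : t \in `[0, K]%R by [].
      rewrite /g /= hornerD hornerN hornerC; under eq_fun => j do rewrite PE.
      apply: cvg_EFin; first exact: nearW.
      rewrite -[X in _ --> X]addr0; apply: cvgD; first exact: cvg_cst.
      rewrite -[X in _ --> X](mulr0 (H n - ln c)); apply: cvgM; first exact: cvg_cst.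
      have hU : `|U.[t] ^+ 2| < 1.
        by rewrite ger0_norm ?exprn_ge0 // exprn_ilt1 // U1.
      by under eq_fun => j do rewrite -muln2 mulnC exprM; exact: cvg_expr hU.
    rewrite notin_setE => tD'; have t0 : t = 0.
      move: Dt tD'; rewrite /D /D' /= !in_itv /= => /andP[t0 ->] /negP.
      by rewrite andbT -leNgt => t0'; apply/eqP; rewrite eq_le t0 t0'.
    rewrite (_ : (fun j => _) = cst 0%:E); first exact: cvg_cst.
    apply/funext => j; rewrite /= PE TE UE t0 expr0n /= mul0r subr0 expr1n mulr1 -/(H n).
    by rewrite -[_ - ln c]opprB subrr.
  - apply: measurable_bounded_integrable => //; exact: bounded_cst.
  - apply: aeW => t j Dt; rewrite /= lee_fin.
    have /U01/andP[U0 U1'] : t \in `[0, K]%R by [].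
    rewrite PE TE -UE.
    have T0 := ln_taylor_ge0 n U0.
    have T1 : (ln_taylor R n).[U.[t]] <= H n by apply: le_ln_taylor; rewrite U0.
    have e0 : 0 <= U.[t] ^+ j.*2 by rewrite exprn_ge0.
    have e1 : U.[t] ^+ j.*2 <= 1 by rewrite exprn_ile1.
    rewrite /B ler_norml; apply/andP; split; nra.
have : (0 <= \int[mu]_(t in D') g t)%E.
  rewrite -[D'](_ : D `&` D' = _); last by rewrite setIidr.
  rewrite integral_mkcondr.
  by apply: (cvge_to_ge cv); exact: nearW.
have -> : g = (cst (ln c)%:E \- (EFin \o horner (T n)))%E.
  by apply/funext => t; rewrite /g /= hornerD hornerN hornerC.
have iT : mu.-integrable D' (EFin \o horner (T n)) by exact: int_horner.
have ic : mu.-integrable D' (cst (ln c)%:E).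
  by apply: measurable_bounded_integrable => //; exact: bounded_cst.
rewrite integralB // integral_cst // => h.
by rewrite -sube_ge0 ?h // (integrable_fin_num mD' iT).
Qed.

Let E (t : R) : R := ln c - ln (t ^+ 2).

(** On [D'] the function [E] is the increasing limit of the polynomials [T n], so monotone
    convergence carries over the bound [taylor_le]. *)
Let int_E : (\int[mu]_(t in D') (E t)%:E <= (ln c)%:E * mu D')%E.
Proof.
have [n0 hn0] := @ln_taylor1_unbounded R (ln c).
(* These degrees are odd and at least [n0], past which [ln c <= H n], as [taylor_le] demands. *)
pose f j (t : R) := ((T (j + n0).*2.+1).[t])%:E.
have -> : (\int[mu]_(t in D') (E t)%:E = \int[mu]_(t in D') limn (f ^~ t))%E.
  apply: eq_integral => t /set_mem tD'.
  apply/esym/cvg_lim => //; apply: cvg_EFin; first exact: nearW.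
  have t0 : t != 0 by move: tD'; rewrite /D' /= in_itv /= => /andP[/gt_eqF -> _].
  have /U01/andP[U0 _] := D'D tD'.
  have h := @cvg_ln_taylor R U.[t] (introT andP (conj U0 (U1 t0))).
  rewrite /E lnE // opprD addrA subrr add0r.
  apply: cvg_trans h => A [N _ hA]; exists N => // j /= Nj.
  rewrite /f /= TE -UE; apply: hA => /=; lia.
rewrite monotone_convergence //; last 3 first.
- by move=> j; apply/measurable_EFinP; exact: measurable_funTS (measurable_horner _).
- move=> j t tD'; rewrite lee_fin TE -UE; apply: ln_taylor_ge0.
  by have /U01/andP[] := D'D tD'.
- move=> t tD' i j ij; rewrite /f lee_fin !TE -UE; apply: nondecreasing_ln_taylor.
    by have /U01/andP[] := D'D tD'.
  by rewrite ltnS leq_double leq_add2r.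
apply: lime_le.
  apply: ereal_nondecreasing_is_cvgn => i j ij; apply: ge0_le_integral => //.
  - move=> t tD'; rewrite lee_fin TE -UE; apply: ln_taylor_ge0.
    by have /U01/andP[] := D'D tD'.
  - by apply/measurable_EFinP; exact: measurable_funTS (measurable_horner _).
  - by apply/measurable_EFinP; exact: measurable_funTS (measurable_horner _).
  - move=> t tD'; rewrite /f lee_fin !TE -UE; apply: nondecreasing_ln_taylor.
      by have /U01/andP[] := D'D tD'.
    by rewrite ltnS leq_double leq_add2r.
apply: nearW => j; apply: taylor_le; first by rewrite /= odd_double.
by apply: hn0; rewrite -addnn; lia.
Qed.

Let measurable_lnR A : measurable_fun (A : set (measurableTypeR R)) (@ln R).
Proof. exact: (measurable_funTS (@measurable_ln R)). Qed.

(** On [D'] one has [ln t = (ln c - E t) / 2], where [E] is nonnegative with integral at most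
    [ln c * mu D']; the rest of the half-line is null. *)
Lemma integrable_ln_ge0 :
  mu.-integrable `]0, +oo[ (fun t : R => (ln t)%:E) /\
  (0 <= \int[mu]_(t in `]0%R, +oo[) (ln t)%:E)%E.
Proof.
have D'E : D' = (`]0, +oo[ `\` ~` D : set R).
  apply/seteqP; split=> t; rewrite /D /D' /= !in_itv /=.
    by move=> /andP[t0 tK]; rewrite t0 (ltW t0) tK; split=> // /(_ isT).
  by rewrite andbT => -[t0 /contrapT /andP[_ ->]]; rewrite t0.
have iE : mu.-integrable D' (EFin \o E).
  have E0 t : D' t -> 0 <= E t.
    move=> tD'; rewrite /E subr_ge0 ler_ln ?posrE //.
      move: tD'; rewrite /D' /= in_itv /= => /andP[t0 tK].
      by rewrite lerXn2r // nnegrE ltW // (lt_le_trans t0).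
    by move: tD'; rewrite /D' /= in_itv /= => /andP[t0 _]; rewrite exprn_gt0.
  apply/integrableP; split.
    apply/measurable_EFinP; rewrite /E; apply: measurable_funB => //.
    apply: measurableT_comp => //; exact: measurable_funX.
  rewrite (_ : (\int[mu]_(t in D') _ = \int[mu]_(t in D') (E t)%:E)%E); last first.
    by apply: eq_integral => t /set_mem /E0 Et; rewrite /= ger0_norm.
  apply: (le_lt_trans int_E); rewrite lte_mul_pinfty // ?lee_fin.
  by rewrite ln_ge0 // exprn_ege1.
have ic : mu.-integrable D' (cst (ln c)%:E).
  by apply: measurable_bounded_integrable => //; exact: bounded_cst.
have lnE' t : t \in D' -> (ln t)%:E = (2^-1%:E * ((cst (ln c)%:E) \- (EFin \o E)) t)%E.
  move=> /set_mem; rewrite /D' /= in_itv /= => /andP[t0 _].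
  rewrite -EFinB -EFinM /E subKr lnXn //; congr _%:E; lra.
have i2 : mu.-integrable D' (fun t => (2^-1%:E * ((cst (ln c)%:E) \- (EFin \o E)) t)%E).
  by apply: integrableZl => //; exact: integrableB.
have iln : mu.-integrable D' (fun t : R => (ln t)%:E).
  by apply: eq_integrable i2 => // t /lnE' ->.
have i3 : mu.-integrable `]0, +oo[ (fun t : R => (ln t)%:E).
  apply/(negligible_integrable (measurableC mD) _ _ mu_supp) => //.
    exact/measurable_EFinP.
  by rewrite -D'E.
split => //.
rewrite (negligible_integral (measurableC mD) _ i3 mu_supp) // -D'E.
have -> : (\int[mu]_(t in D') (ln t)%:E =
  \int[mu]_(t in D') (2^-1%:E * ((cst (ln c)%:E) \- (EFin \o E)) t))%E.
  by apply: eq_integral => t tD'; rewrite -lnE'.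
rewrite integralZl //; last exact: integrableB.
rewrite mule_ge0 ?lee_fin // integralB // integral_cst // sube_ge0 //.
by rewrite (integrable_fin_num mD' iE).
Qed.
End LogIntegral.

(** * Finite models of group ring matrices *)

(** The map [phi] need not be multiplicative: traces of powers of a group ring matrix only test
    which short products over [S] are 1. *)
Definition locally_finite_embeddable (G : groupType) : Prop :=
  forall (S : seq G) (L : nat), exists (H : finGroupType) (phi : G -> H),
    forall w : seq G, {subset w <= S} -> (size w <= L)%N ->
      (\prod_(g <- w) g = 1)%g <-> (\prod_(g <- w) phi g = 1)%g.

Section Words.
Variables (T : Type) (S : seq T).

Fixpoint words k : seq (seq T) :=
  if k is k'.+1 then [seq g :: w | g <- S, w <- words k'] else [:: [::]].

Lemma big_words (V : nmodType) k (F : seq T -> V) :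
  \sum_(w <- words k.+1) F w = \sum_(g <- S) \sum_(w <- words k) F (g :: w).
Proof. by rewrite big_allpairs_dep. Qed.
End Words.

Lemma words_subset (T : eqType) (S : seq T) k w :
  w \in words S k -> {subset w <= S} /\ size w = k.
Proof.
elim: k w => [|k IH] w /=; first by rewrite inE => /eqP ->.
case/allpairsP => -[g v] /= [gS /IH[vS <-] ->]; split=> // x.
by rewrite inE => /predU1P[->|/vS].
Qed.

Section FiniteModel.
Variables (G : groupType) (d : nat) (S : seq G) (D : G -> 'M[int]_d).
Hypotheses (S_uniq : uniq S) (S_inv : {in S, forall g, (g^-1)%g \in S}).
Hypothesis D_sym : forall g, D (g^-1)%g = (D g)^T.

(** The trace of the [k]-th power of the group ring matrix with coefficients [D g], expanded over
    words: only words with product 1 contribute. *)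
Definition trace_moment k : int :=
  \sum_(w <- words S k) \tr (\prod_(g <- w) D g) *+ (\prod_(g <- w) g == 1)%g.

Variables (H : finGroupType) (phi : G -> H).

Let n := #|{: 'I_d * H}|.

(** The matrix of the sum over [S] of [D g] times left multiplication by [phi g], acting on [Z[H]^d]
    with basis enumerated by ['I_d * H]. *)
Definition finite_model : 'M[int]_n :=
  \matrix_(a, b) \sum_(g <- S)
    D g (enum_val a).1 (enum_val b).1 *+ ((enum_val a).2 == (phi g * (enum_val b).2)%g).

Lemma finite_modelX k a b : (finite_model ^+ k) a b =
  \sum_(w <- words S k) (\prod_(g <- w) D g) (enum_val a).1 (enum_val b).1 *+
     ((enum_val a).2 == (\prod_(g <- w) phi g * (enum_val b).2)%g).
Proof.
elim: k a b => [|k IH] a b.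
  rewrite expr0 /= big_seq1 !big_nil mul1g -[1 in LHS]/(1%:M) -[1 in RHS]/(1%:M) !mxE.
  rewrite -(inj_eq enum_val_inj); case: (enum_val a) (enum_val b) => [i h] [j h'] /=.
  by rewrite xpair_eqE; case: (i == j); case: (h == h').
rewrite exprS -[_ * _]/(_ *m _) mxE big_words.
under eq_bigr => c _.
  rewrite IH mxE big_distrl /=. over.
rewrite exchange_big /=; apply: eq_bigr => g _.
under eq_bigr => c _ do rewrite big_distrr /=.
rewrite exchange_big /=; apply: eq_bigr => w _.
rewrite (reindex (@enum_rank _)) /=; last by exists enum_val => c _; rewrite ?enum_rankK ?enum_valK.
under eq_bigr => c _ do rewrite enum_rankK.
case: (enum_val a) (enum_val b) => [i h] [j h'] /=.
rewrite !big_cons -[D g * _]/(D g *m _) mxE -sumrMnl.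
rewrite -(pair_bigA _ (fun l f => D g i l *+ (h == phi g * f)%g *
   ((\prod_(g0 <- w) D g0) l j *+ (f == \prod_(g0 <- w) phi g0 * h')%g))) /=.
apply: eq_bigr => l _.
rewrite (bigD1 (\prod_(g0 <- w) phi g0 * h')%g) //= eqxx mulr1n [X in _ + X]big1 ?addr0.
  by rewrite mulgA mulrnAl.
by move=> f /negPf ->; rewrite mulr0n mulr0.
Qed.

(** Left multiplication by the image of a word fixes all elements of [H] or none, so a word
    contributes with factor [#|H|] or 0; the hypothesis makes this dichotomy that of [G]. *)
Lemma mxtrace_finite_model k :
  (forall w : seq G, {subset w <= S} -> (size w <= k)%N ->
      (\prod_(g <- w) g = 1)%g <-> (\prod_(g <- w) phi g = 1)%g) ->
  \tr (finite_model ^+ k) = trace_moment k *+ #|H|.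
Proof.
move=> phiP; rewrite /mxtrace; under eq_bigr => a _ do rewrite finite_modelX.
rewrite exchange_big /= -sumrMnl big_seq [RHS]big_seq; apply: eq_bigr => w /words_subset[wS wk].
rewrite (reindex (@enum_rank _)) /=; last by exists enum_val => c _; rewrite ?enum_rankK ?enum_valK.
under eq_bigr => c _ do rewrite enum_rankK eq_sym -[X in _ == X]mul1g (inj_eq (mulIg _)).
rewrite -(pair_bigA _ (fun l f => (\prod_(g <- w) D g) l l *+ (\prod_(g <- w) phi g == 1)%g)) /=.
under eq_bigr => l _ do rewrite sumr_const.
rewrite -mulrnA -!sumrMnl; apply: eq_bigr => l _; rewrite -mulrnA; congr (_ *+ _).
rewrite cardE -cardT; congr muln; congr nat_of_bool.
by apply/eqP/eqP => /phiP; apply; rewrite ?wk.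
Qed.

(** The words [g g^-1] of length 2 show that [phi] respects inverses on [S]; transposing then
    amounts to reindexing the sum over [S] by inversion. *)
Lemma finite_model_sym :
  (forall w : seq G, {subset w <= S} -> (size w <= 2)%N ->
      (\prod_(g <- w) g = 1)%g <-> (\prod_(g <- w) phi g = 1)%g) ->
  finite_model^T = finite_model.
Proof.
move=> phiP.
have phiV : {in S, forall g, phi (g^-1)%g = ((phi g)^-1)%g}.
  move=> g gS; apply/eqP; rewrite eq_sym eq_invg_mul; apply/eqP.
  have := phiP [:: g; (g^-1)%g]; rewrite !big_cons !big_nil !mulg1 mulgV.
  case=> //; last by move=> h _; exact: h.
  by move=> x; rewrite !inE => /orP[] /eqP -> //; exact: S_inv.
have permS : perm_eq S [seq (g^-1)%g | g <- S].
  apply: uniq_perm => //; first by rewrite map_inj_uniq //; exact: invg_inj.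
  move=> g; apply/idP/mapP => [gS|[h hS ->]]; last exact: S_inv.
  by exists (g^-1)%g; rewrite ?invgK // S_inv.
apply/matrixP => a b; rewrite !mxE (perm_big _ permS) big_map big_seq [RHS]big_seq.
apply: eq_bigr => g gS; rewrite phiV // D_sym mxE; congr (_ *+ nat_of_bool _).
by rewrite -(inj_eq (mulgI (phi g))) mulKVg eq_sym.
Qed.
End FiniteModel.

Lemma moment_ge0 (R : realType) (G : groupType) (d : nat) (S : seq G) (D : G -> 'M[int]_d)
    (p : {poly R}) : locally_finite_embeddable G ->
  uniq S -> {in S, forall g, (g^-1)%g \in S} -> (forall g, D (g^-1)%g = (D g)^T) ->
  0 <= p.[0] -> (forall t : R, t != 0 -> ln (t ^+ 2) <= p.[t]) ->
  0 <= \sum_(k < size p) p`_k * (trace_moment S D k)%:~R.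
Proof.
move=> lfe uS iS symD p0 lnp.
(* Length 2 is for the symmetry of the model, [size p] for the traces of the powers occurring in
   [p]. *)
have [H [phi phiP]] := lfe S (maxn 2 (size p)).
have := @symmetric_int_mx_trace_ge0 R _ (finite_model S D phi) p _ p0 lnp.
rewrite finite_model_sym //; last by move=> w wS w2; apply: phiP => //; rewrite leq_max w2.
move=> /(_ erefl).
under eq_bigr => k _.
  rewrite mxtrace_finite_model; last first.
    by move=> w wS wk; apply: phiP => //; rewrite leq_max (leq_trans wk (ltnW (ltn_ord k))) orbT.
  rewrite -mulr_natr rmorphM /= mulrA natz. over.
by rewrite -mulr_suml pmulr_lge0 // ltr0z ltz_nat; apply/card_gt0P; exists 1%g.
Qed.

(** * Stieltjes measures of spectral distributions *)

Section Stieltjes.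
Variables (R : realType) (mu : {measure set (measurableTypeR R) -> \bar R}).
Hypothesis mu_fin : (mu setT < +oo)%E.

(* The first alternative is the junk value of stieltjes for F not cumulative. *)
Lemma stieltjes_of_measure (F : R -> R) :
  (forall t, F t = fine (mu `]-oo, t]%classic)) ->
  stieltjes F = mzero \/
  exists nu : {measure set (measurableTypeR R) -> \bar R},
    stieltjes F = nu /\ forall A, measurable A -> nu A = mu A.
Proof.
move=> FE; rewrite /stieltjes; case: pselect => [e|_]; last by left.
right; exists (lebesgue_stieltjes_measure (projT1 (cid e))); split=> // A mA.
case: (cid e) => f fF /=.
apply: lebesgue_stieltjes_measure_unique => // X /ocitvP[->|[[a b] /= ab ->]].
  by rewrite !measure0.
rewrite /lebesgue_stieltjes_measure /measure_extension measurable_mu_extE /=; last exact: is_ocitv.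
rewrite wlength_itv_bnd 1?ltW // fF !FE.
have mi (i : interval R) : measurable ([set` i] : set (measurableTypeR R)) by exact: measurable_itv.
have fini (i : interval R) : mu [set` i] \is a fin_num.
  rewrite ge0_fin_numE // (le_lt_trans _ mu_fin) //; apply: le_measure; rewrite ?inE //.
rewrite EFinB !fineK //.
have -> : `]-oo, b]%classic = `]-oo, a]%classic `|` `]a, b]%classic :> set R.
  by rewrite -itv_bndbnd_setU // bnd_simp ltW.
rewrite measureU //; last first.
  apply/seteqP; split=> t //= []; rewrite !in_itv /= => ta /andP[at_ _].
  by move: (lt_le_trans at_ ta); rewrite ltxx.
by rewrite addeAC subee; [rewrite add0e|exact: fini].
Qed.
End Stieltjes.

Lemma stieltjes_ln_ge0 (R : realType) (mu : {measure set (measurableTypeR R) -> \bar R})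
    (F : R -> R) (K : R) :
  (forall t, F t = fine (mu `]-oo, t]%classic)) ->
  1 <= K -> (mu setT < +oo)%E -> mu (~` `[0, K]) = 0%E ->
  (forall p : {poly R}, 0 <= p.[0] ->
    (forall t : R, t != 0 -> ln (t ^+ 2) <= p.[t]) -> (0 <= \int[mu]_t (p.[t])%:E)%E) ->
  (stieltjes F).-integrable `]0, +oo[ (fun t => (ln t)%:E) /\
  (0 <= \int[stieltjes F]_(t in `]0%R, +oo[) (ln t)%:E)%E.
Proof.
move=> FE K1 fin supp mu_ln.
have [->|[nu [-> nuE]]] := stieltjes_of_measure fin FE.
  rewrite integral_measure_zero; split=> //; apply/integrableP; split.
    by apply/measurable_EFinP; exact: (measurable_funTS (@measurable_ln R)).
  by rewrite integral_measure_zero.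
apply: (integrable_ln_ge0 K1); rewrite ?nuE //; first by apply: measurableC; exact: measurable_itv.
move=> p p0 lnp; rewrite (@eq_measure_integral _ _ _ _ mu); first exact: mu_ln.
by move=> A mA _; rewrite nuE.
Qed.

(** * Operators on square summable vectors *)

Section SquareSummable.
Variables (R : realType) (T : choiceType).
Implicit Types (x y : T -> R[i]) (t : T).

Lemma esum_supp1 (f : T -> \bar R) t :
  (forall u, 0 <= f u)%E -> (forall u, u != t -> f u = 0%E) ->
  (\esum_(u in setT) f u = f t)%E.
Proof.
move=> f0 fE; rewrite -(@esum_set1 _ _ t f) // [RHS]esum_mkcond.
apply: eq_esum => u _; case: ifPn => // /negP ut; apply: fE; apply/eqP => ut'.
by apply: ut; rewrite inE.
Qed.

Lemma real_sum_supp1 (f : T -> R) t : (forall u, u != t -> f u = 0) -> real_sum f = f t.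
Proof.
move=> fE; rewrite /real_sum !(@esum_supp1 _ t) //; last 2 first.
- by move=> u ut; rewrite funenegE /= fE // oppr0 maxxx.
- by move=> u ut; rewrite funeposE /= fE // maxxx.
rewrite funeposE funenegE /=.
rewrite -!EFin_max /=; have [ft|/ltW ft] := leP 0 (f t).
  by rewrite max_r ?oppr_le0 // subr0.
by rewrite max_l ?oppr_ge0 // sub0r opprK.
Qed.

Lemma l2dot_supp1 x y t : (forall u, u != t -> x u * conjc (y u) = 0) ->
  l2dot x y = x t * conjc (y t).
Proof.
move=> xyE; rewrite /l2dot /complex_sum !(@real_sum_supp1 _ t).
- by case: (x t * _).
- by move=> u /xyE ->.
- by move=> u /xyE ->.
Qed.

Definition dirac_vec t : T -> R[i] := fun u => (u == t)%:R.

Lemma l2dot_diracr x t : l2dot x (dirac_vec t) = x t.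
Proof.
rewrite (@l2dot_supp1 _ _ t); first by rewrite /dirac_vec eqxx conjc1 mulr1.
by move=> u /negPf ut; rewrite /dirac_vec ut conjc0 mulr0.
Qed.

Lemma l2dot_diracl x t : l2dot (dirac_vec t) x = conjc (x t).
Proof.
rewrite (@l2dot_supp1 _ _ t); first by rewrite /dirac_vec eqxx mul1r.
by move=> u /negPf ut; rewrite /dirac_vec ut mul0r.
Qed.

Lemma complex_sum0 : complex_sum (fun _ : T => 0 : R[i]) = 0.
Proof.
rewrite /complex_sum /=.
suff -> : real_sum (fun _ : T => 0 : R) = 0 by [].
rewrite /real_sum !esum1 ?subrr // => t _; first by rewrite funenegE /= oppr0 maxxx.
by rewrite funeposE /= maxxx.
Qed.

Lemma l2dot0r x : l2dot x (fun=> 0) = 0.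
Proof.
rewrite /l2dot (_ : (fun t => _) = fun=> 0) ?complex_sum0 //.
by apply/funext => t; rewrite conjc0 mulr0.
Qed.

Lemma l2dot0l x : l2dot (fun=> 0) x = 0.
Proof.
rewrite /l2dot (_ : (fun t => _) = fun=> 0) ?complex_sum0 //.
by apply/funext => t; rewrite mul0r.
Qed.

Lemma ell2_0 : ell2 (fun _ : T => 0 : R[i]).
Proof. by rewrite /ell2 /= /l2norm2 esum1 ?ltry // => t _; rewrite /= expr0n addr0. Qed.

Lemma ell2_dirac t : ell2 (dirac_vec t).
Proof.
rewrite /ell2 /= /l2norm2 (@esum_supp1 _ t) ?ltry // => u.
  by rewrite lee_fin addr_ge0 // sqr_ge0.
by move=> /negPf ut; rewrite /dirac_vec ut /= expr0n addr0.
Qed.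

Lemma ell2D x y : ell2 x -> ell2 y -> ell2 (fun t => x t + y t).
Proof.
rewrite /ell2 /= => hx hy.
(* Pointwise, [|x + y|^2 <= 2 |x|^2 + 2 |y|^2]. *)
have := lte_add_pinfty (lte_add_pinfty hx hx) (lte_add_pinfty hy hy).
apply: le_lt_trans; have sq0 (z : R[i]) : (0 <= (complex.Re z ^+ 2 + complex.Im z ^+ 2)%:E)%E.
  by rewrite lee_fin addr_ge0 // sqr_ge0.
rewrite /l2norm2 -!esumD //; try by move=> *; rewrite ?adde_ge0.
apply: le_esum => t _; rewrite -!EFinD lee_fin.
case: (x t) (y t) => [a b] [a' b'] /=.
have := sqr_ge0 (a - a'); have := sqr_ge0 (b - b'); nra.
Qed.

End SquareSummable.

(** * Group ring matrices acting on square summable vectors *)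

Section GroupRingOperators.
Variables (R : realType) (G : groupType) (d : nat).
Local Notation C := R[i].
Local Notation dvec := ('I_d -> G -> C).

Definition dirac_dvec (i : 'I_d) (h : G) : dvec :=
  fun j => if j == i then dirac_vec R h else fun=> 0.

Lemma ell2d_dirac i h : ell2d (dirac_dvec i h).
Proof. by move=> j; rewrite /dirac_dvec; case: eqP => _; [exact: ell2_dirac|exact: ell2_0]. Qed.

Lemma dotd_diracr (x : dvec) i h : dotd x (dirac_dvec i h) = x i h.
Proof.
rewrite /dotd (bigD1 i) //= big1 => [|j /negPf ji].
  by rewrite addr0 /dirac_dvec eqxx l2dot_diracr.
by rewrite /dirac_dvec ji l2dot0r.
Qed.

Lemma dotd_diracl (x : dvec) i h : dotd (dirac_dvec i h) x = conjc (x i h).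
Proof.
rewrite /dotd (bigD1 i) //= big1 => [|j /negPf ji].
  by rewrite addr0 /dirac_dvec eqxx l2dot_diracl.
by rewrite /dirac_dvec ji l2dot0l.
Qed.

Lemma left_convE (S : seq G) (a : group_ring G) (x : G -> C) g :
  uniq S -> {subset finsupp a <= S} ->
  left_conv a x g = \sum_(h <- S) (a h)%:~R * x (h^-1 * g)%g.
Proof.
move=> uS aS; rewrite /left_conv; apply/esym.
rewrite (bigID (mem (finsupp a))) /= [X in _ + X]big1 ?addr0; last first.
  by move=> h ha; rewrite fsfun_dflt ?mul0r.
rewrite -big_filter; apply: perm_big; apply: uniq_perm; rewrite ?filter_uniq ?fset_uniq //.
by move=> h; rewrite mem_filter; apply/andP/idP => [[]|ha] //; split=> //; exact: aS.
Qed.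

Lemma left_conv_dirac (a : group_ring G) k g :
  left_conv a (dirac_vec R k) g = (a (g * k^-1)%g)%:~R.
Proof.
pose S := undup ((g * k^-1)%g :: finsupp a).
rewrite (@left_convE S) ?undup_uniq //; last first.
  by move=> h ha; rewrite mem_undup inE ha orbT.
rewrite (bigD1_seq (g * k^-1)%g) ?undup_uniq ?mem_undup ?mem_head //= big1.
  by rewrite /dirac_vec invMg invgK mulgKV eqxx mulr1 addr0.
move=> h hg; rewrite /dirac_vec; case: eqP => [hk|_]; last by rewrite mulr0.
by case/eqP: hg; rewrite -hk invMg invgK mulKVg.
Qed.

Lemma left_conv0 (a : group_ring G) : left_conv a (fun=> 0) = (fun=> 0 : C).
Proof. by apply/funext => g; rewrite /left_conv big1 // => h _; rewrite mulr0. Qed.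

Variable Delta : 'M[group_ring G]_d.
Let A := map_mx (@left_conv R G) Delta.

Definition coef_mx (g : G) : 'M[int]_d := \matrix_(i, j) Delta i j g.

Definition mx_supp : seq G :=
  flatten [seq (finsupp (Delta ij.1 ij.2) : seq G) | ij <- enum {: 'I_d * 'I_d}].

Definition sym_supp : seq G := undup (mx_supp ++ [seq (g^-1)%g | g <- mx_supp]).

Lemma sym_supp_inv : {in sym_supp, forall g, (g^-1)%g \in sym_supp}.
Proof.
move=> g; rewrite !mem_undup !mem_cat => /orP[gS|/mapP[h hS ->]].
  by rewrite orbC map_f.
by rewrite invgK hS.
Qed.

Lemma finsupp_sym_supp i j : {subset finsupp (Delta i j) <= sym_supp}.
Proof.
move=> g gD; rewrite mem_undup mem_cat; apply/orP; left.
by apply/flattenP; exists (finsupp (Delta i j) : seq G) => //; apply/mapP; exists (i, j);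
  rewrite ?mem_enum.
Qed.

Let act_diracE i h j g : mx_act A (dirac_dvec i h) j g = (Delta j i (g * h^-1)%g)%:~R.
Proof.
rewrite /mx_act (bigD1 i) //= big1 => [|l /negPf li].
  by rewrite addr0 mxE /dirac_dvec eqxx left_conv_dirac.
by rewrite mxE /dirac_dvec li left_conv0.
Qed.

(** Self-adjointness is tested on basis vectors located at 1 and at [g]; integer coefficients are
    their own conjugates. *)
Lemma self_adjoint_coef : self_adjoint A -> forall g, coef_mx (g^-1)%g = (coef_mx g)^T.
Proof.
move=> sA g; apply/matrixP => i j; rewrite !mxE.
have := sA _ _ (@ell2d_dirac i 1%g) (@ell2d_dirac j g).
rewrite dotd_diracr dotd_diracl !act_diracE invg1 mulg1 mul1g rmorph_int => h.
apply/esym/eqP; rewrite -(eqr_int C) h; apply/eqP.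
by [].
Qed.

Let mx_actE (x : dvec) i g : mx_act A x i g =
  \sum_j \sum_(h <- sym_supp) (coef_mx h i j)%:~R * x j (h^-1 * g)%g.
Proof.
apply: eq_bigr => j _; rewrite mxE (@left_convE sym_supp) ?undup_uniq //.
  by apply: eq_bigr => h _; rewrite mxE.
exact: finsupp_sym_supp.
Qed.

Lemma mx_act_iterE k (x : dvec) i g : iter k (mx_act A) x i g =
  \sum_(w <- words sym_supp k) \sum_j ((\prod_(h <- w) coef_mx h) i j)%:~R *
     x j ((\prod_(h <- w) h)^-1 * g)%g.
Proof.
elim: k i g => [|k IH] i g.
  have oneE (a b : 'I_d) : (1 : 'M[int]_d) a b = (a == b)%:R by rewrite -[1 in LHS]/(1%:M) mxE.
  rewrite /= big_seq1 !big_nil invg1 mul1g (bigD1 i) //= oneE eqxx mul1r.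
  by rewrite big1 ?addr0 // => j /negPf ji; rewrite oneE eq_sym ji mul0r.
rewrite big_words iterS mx_actE.
under eq_bigr => j _ do under eq_bigr => h _ do rewrite IH mulr_sumr.
rewrite exchange_big /=; apply: eq_bigr => h _.
rewrite exchange_big /=; apply: eq_bigr => w _.
under eq_bigr => j _ do rewrite mulr_sumr.
rewrite exchange_big /=; apply: eq_bigr => l _.
rewrite !big_cons -[coef_mx h * _]/(coef_mx h *m _) mxE rmorph_sum mulr_suml.
apply: eq_bigr => j _; rewrite rmorphM /= mulrA; congr (_ * x l _).
by rewrite invMg mulgA.
Qed.

(** The left side is the von Neumann trace of the [k]-th power of [A], that is, the [k]-th moment of
    its spectral measure. *)
Lemma trace_iter k :
  \sum_i iter k (mx_act A) (dirac_dvec i 1%g) i 1%g = (trace_moment sym_supp coef_mx k)%:~R.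
Proof.
under eq_bigr => i _ do rewrite mx_act_iterE.
rewrite exchange_big /= rmorph_sum; apply: eq_bigr => w _ /=.
rewrite -sumrMnl rmorph_sum; apply: eq_bigr => i _ /=.
rewrite (bigD1 i) //= [X in _ + X]big1 => [|j /negPf ji].
  by rewrite addr0 /dirac_dvec eqxx /dirac_vec mulg1 invg_eq1 rmorphMn /= -[RHS]mulr_natr.
by rewrite /dirac_dvec ji mulr0.
Qed.

End GroupRingOperators.

Definition mx_l1norm d (M : 'M[int]_d) : int := \sum_i \sum_j `|M i j|.

Lemma mx_l1norm_ge0 d (M : 'M[int]_d) : 0 <= mx_l1norm M.
Proof. by apply: sumr_ge0 => i _; apply: sumr_ge0. Qed.

Lemma mx_l1normM d (M N : 'M[int]_d) : mx_l1norm (M *m N) <= mx_l1norm M * mx_l1norm N.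
Proof.
rewrite mulr_suml; apply: ler_sum => i _; rewrite mulr_suml.
apply: (@le_trans _ _ (\sum_j \sum_k `|M i k| * `|N k j|)).
  apply: ler_sum => j _; rewrite mxE (le_trans (ler_norm_sum _ _ _)) //.
  by apply: ler_sum => k _; rewrite normrM.
rewrite exchange_big; apply: ler_sum => k _ /=; rewrite -mulr_sumr ler_wpM2l //.
by rewrite /mx_l1norm [leRHS](bigD1 k) //= lerDl sumr_ge0 // => l _; apply: sumr_ge0.
Qed.

(** All words are kept, whatever their product; the norm dominates the trace and is
    submultiplicative, so the sum over words is bounded by a power. This geometric growth later
    bounds the support of the spectral measure. *)
Lemma norm_trace_moment_le (G : groupType) d (S : seq G) (D : G -> 'M[int]_d) k :
  `|trace_moment S D k| <= d%:Z * (\sum_(g <- S) mx_l1norm (D g)) ^+ k.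
Proof.
apply: (@le_trans _ _ (\sum_(w <- words S k) mx_l1norm (\prod_(g <- w) D g))).
  rewrite (le_trans (ler_norm_sum _ _ _)) //; apply: ler_sum => w _.
  apply: (@le_trans _ _ `|\tr (\prod_(g <- w) D g)|).
    by case: (_ == _); rewrite ?mulr1n // mulr0n normr0.
  rewrite (le_trans (ler_norm_sum _ _ _)) //; apply: ler_sum => i _.
  by rewrite [leRHS](bigD1 i) //= lerDl sumr_ge0.
elim: k => [|k IH].
  rewrite /= big_seq1 big_nil expr0 mulr1 /mx_l1norm.
  rewrite (eq_bigr (fun=> 1)) ?sumr_const ?card_ord ?natz //.
  move=> i _; rewrite (bigD1 i) //= big1 => [|j /negPf ji].
    by rewrite -[1 in LHS]/(1%:M) mxE eqxx.
  by rewrite -[1 in LHS]/(1%:M) mxE eq_sym ji.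
rewrite big_words exprS mulrCA mulr_suml; apply: ler_sum => g _.
apply: le_trans (ler_wpM2l (mx_l1norm_ge0 _) IH).
rewrite mulr_sumr; apply: ler_sum => w _.
by rewrite big_cons; apply: mx_l1normM.
Qed.

(** * Scalar spectral measures at basis vectors *)

Section SpectralMeasure.
Variables (R : realType) (G : groupType) (d : nat).
Local Notation dop := 'M[(G -> R[i]) -> (G -> R[i])]_d.
Implicit Types (A : dop) (x y : 'I_d -> G -> R[i]).

Lemma ell2d_mx_act A x : mx_vN A -> ell2d x -> ell2d (mx_act A x).
Proof.
move=> vA hx i; rewrite /mx_act.
have : forall s : seq 'I_d, ell2 (fun g => \sum_(j <- s) A i j (x j) g).
  elim=> [|j s IH].
    rewrite (_ : (fun g => _) = fun=> 0); first exact: ell2_0.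
    by apply/funext => g; rewrite big_nil.
  rewrite (_ : (fun g => _) = (fun g => A i j (x j) g + \sum_(j <- s) A i j (x j) g)); last first.
    by apply/funext => g; rewrite big_cons.
  apply: ell2D => //; have [[_ [M hM]] _] := vA i j.
  rewrite /ell2 /=; apply: le_lt_trans (hM _ (hx j)) _.
  have l0 : (0 <= l2norm2 (x j))%E.
    by apply: esum_ge0 => t _; rewrite lee_fin addr_ge0 // sqr_ge0.
  have := hx j; rewrite /ell2 /= => xj.
  by rewrite -(@fineK _ (l2norm2 (x j))) ?ge0_fin_numE // -EFinM ltry.
exact.
Qed.

Lemma group_vN0 (a : (G -> R[i]) -> G -> R[i]) : group_vN a -> a (fun=> 0) = fun=> 0.
Proof.
move=> [[lin _] _].
have := lin 1 _ _ (@ell2_0 R G) (@ell2_0 R G).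
rewrite (_ : (fun g : G => 1 * 0 + 0) = fun=> 0); last by apply/funext => g; rewrite mul1r addr0.
move=> h; apply/funext => g; have := congr1 (fun f => f g) h.
by rewrite mul1r => /esym/eqP; rewrite -subr_eq0 addrK => /eqP.
Qed.

Lemma mx_act_dirac_diag A i : mx_vN A ->
  mx_act A (dirac_dvec R i 1%g) i 1%g = vN_trace (A i i).
Proof.
move=> vA; rewrite /mx_act (bigD1 i) //= big1 => [|j /negPf ji].
  rewrite addr0 /dirac_dvec eqxx /vN_trace.
  by rewrite (_ : @unit_vec R G = dirac_vec R 1%g) // l2dot_diracr.
by rewrite /dirac_dvec ji group_vN0.
Qed.

Variables (A : dop) (E : set R -> dop).
Hypothesis specE : is_spectral_measure A E.

Let vE B : measurable B -> mx_vN (E B).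
Proof. by case: specE => h _ _ _ /h[]. Qed.

Let saE B : measurable B -> self_adjoint (E B).
Proof. by case: specE => h _ _ _ /h[]. Qed.

Let meas_x x : ell2d x -> {mu : {measure set (measurableTypeR R) -> \bar R} |
  (forall B, measurable B -> mu B = (complex.Re (dotd (mx_act (E B) x) x))%:E) /\
  (forall n : nat, (\int[mu]_t (t ^+ n)%:E)%E = (complex.Re (dotd (iter n (mx_act A) x) x))%:E)}.
Proof. by case: specE => _ _ _ h hx; exact: cid (h x hx). Qed.

Definition spec_mu i : {measure set (measurableTypeR R) -> \bar R} :=
  projT1 (meas_x (@ell2d_dirac R G d i 1%g)).

Let spec_mu_dot i B : measurable B -> spec_mu i B =
  (complex.Re (dotd (mx_act (E B) (dirac_dvec R i 1%g)) (dirac_dvec R i 1%g)))%:E.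
Proof. exact: (proj1 (projT2 (meas_x (@ell2d_dirac R G d i 1%g))) B). Qed.

Lemma spec_muE i B : measurable B -> spec_mu i B = (complex.Re (vN_trace (E B i i)))%:E.
Proof. by move=> mB; rewrite spec_mu_dot // dotd_diracr mx_act_dirac_diag //; exact: vE. Qed.

Lemma spec_mu_moment i n : (\int[spec_mu i]_t (t ^+ n)%:E)%E =
  (complex.Re (iter n (mx_act A) (dirac_dvec R i 1%g) i 1%g))%:E.
Proof. by rewrite /spec_mu; case: meas_x => mu /= [_ ->]; rewrite dotd_diracr. Qed.

(* For x = E(B) y with B the negative half-line, mu_x is the restriction of mu_y to B, and
   positivity of its first moment <A x, x> forces it to vanish. *)
Lemma spec_mu_neg i : positive_op A -> spec_mu i `]-oo, 0[%classic = 0%E.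
Proof.
move=> posA.
set B := `]-oo, 0[%classic : set R.
have mB : measurable (B : set (measurableTypeR R)) by exact: measurable_itv.
have hy := @ell2d_dirac R G d i 1%g.
set y := dirac_dvec R i 1%g in hy.
have hx : ell2d (mx_act (E B) y) by apply: ell2d_mx_act => //; exact: vE.
have [nu [nuE nu1]] := meas_x hx.
have nu_mu C : measurable C -> nu C = spec_mu i (C `&` B).
  move=> mC; have mCB : measurable (C `&` B : set (measurableTypeR R)) by exact: measurableI.
  rewrite (nuE _ mC) (spec_mu_dot _ mCB).
  have mB' : measurable (B : set R) by [].
  have mC' : measurable (C : set R) by [].
  have mCB' : measurable (C `&` B : set R) by [].
  congr (complex.Re _)%:E; rewrite -(saE mB') //; last first.
    by apply: ell2d_mx_act => //; exact: vE.
  case: specE => _ _ EI _; rewrite -!EI //.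
    by rewrite setIAC setIid setIC.
  by rewrite setIC.
have := nu1 1%N; rewrite /= => int1.
have : (0 <= \int[nu]_t (t ^+ 1)%:E)%E.
  by rewrite int1 lee_fin; have := posA _ hx; rewrite lecE => /andP[].
move=> int_ge0.
have nuBC : nu (~` B) = 0%E.
  by rewrite (nu_mu _ (measurableC mB)) setICl measure0.
have mf : measurable_fun (setT : set (measurableTypeR R)) (fun t : R => (t ^+ 1)%:E).
  by apply/measurable_EFinP; exact: measurable_funX.
have nuB : spec_mu i B = nu B by rewrite (nu_mu _ mB) setIid.
rewrite nuB.
set f : R -> \bar R := (fun t => (t ^+ 1)%:E) in int_ge0 mf.
have pos0 : (\int[nu]_t f^\+ t = 0)%E.
  rewrite (ge0_negligible_integral (measurableC mB)) //; last first.
    exact: measurable_funepos.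
  rewrite setTD setCK; apply: integral0_eq => t tB.
  rewrite funeposE /f expr1; apply/max_idPr.
  by move: tB; rewrite /B /= in_itv /= lee_fin => /ltW.
have neg0 : (\int[nu]_t f^\- t = 0)%E.
  apply/eqP; rewrite eq_le integral_ge0 // andbT.
  by move: int_ge0; rewrite integralE pos0 sub0e oppe_ge0.
have /ae_eq_integral_abs : (\int[nu]_t `|f^\- t| = 0)%E.
  by rewrite -[RHS]neg0; apply: eq_integral => t _; rewrite gee0_abs.
move=> /(_ measurableT) [|N [mN N0 subN]].
  exact: measurable_funeneg.
apply: (subset_measure0 mB mN _ N0) => t tB; apply: subN => /= /(_ Logic.I).
rewrite funenegE /f expr1 => /max_idPr.
rewrite oppe_le0 lee_fin; move: tB; rewrite /B /= in_itv /= => /lt_geF -> //.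
Qed.

End SpectralMeasure.

(** * The determinant conjecture *)

Section Moments.
Variable R : realType.
Implicit Types (nu : {measure set (measurableTypeR R) -> \bar R}) (a : nat -> R).

Let measurable_pow n : measurable_fun (setT : set (measurableTypeR R)) (fun t : R => t ^+ n).
Proof. exact: measurable_funX. Qed.

Let even_pow_ge0 n (t : R) : 0 <= t ^+ n.*2.
Proof. by rewrite -muln2 mulnC exprM exprn_ge0 // sqr_ge0. Qed.

Section OneMeasure.
Variables (nu : {measure set (measurableTypeR R) -> \bar R}) (a : nat -> R).
Hypothesis nu_a : forall n, (\int[nu]_t (t ^+ n)%:E)%E = (a n)%:E.

Lemma moment_total : nu setT = (a 0%N)%:E.
Proof.
rewrite -nu_a; under eq_integral => t _ do rewrite expr0.
by rewrite (integral_cst _ measurableT) mul1e.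
Qed.

(** For even powers the integrand is nonnegative, so a finite moment gives integrability; any power
    is dominated through [|t ^+ n| <= 1 + t ^+ n.*2]. *)
Lemma integrable_pow n : nu.-integrable setT (fun t : R => (t ^+ n)%:E).
Proof.
have even k : nu.-integrable setT (fun t : R => (t ^+ k.*2)%:E).
  apply/integrableP; split; first exact/measurable_EFinP.
  have -> : (\int[nu]_t `|(t ^+ k.*2)%:E| = (a k.*2)%:E)%E.
    by rewrite -nu_a; apply: eq_integral => t _; rewrite gee0_abs // lee_fin.
  exact: ltry.
apply: (@le_integrable _ _ _ nu setT measurableT _ (fun t : R =>
  (t ^+ 0.*2)%:E + (t ^+ n.*2)%:E)%E).
- exact/measurable_EFinP.
- move=> t _; rewrite -EFinD !abse_EFin lee_fin -!muln2 !exprM.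
  rewrite [leRHS]ger0_norm ?expr0 ?expr1n; last by rewrite addr_ge0 // sqr_ge0.
  set x := t ^+ n; have := sqr_ge0 (x + 1); have := sqr_ge0 (x - 1).
  by rewrite ler_norml => h1 h2; apply/andP; split; nra.
- exact: integrableD.
Qed.

Lemma integral_horner (p : {poly R}) :
  (\int[nu]_t (p.[t])%:E)%E = (\sum_(k < size p) p`_k * a k)%:E.
Proof.
rewrite -sumEFin.
transitivity (\int[nu]_t \sum_(k < size p) ((p`_k)%:E * (t ^+ k)%:E))%E.
  by apply: eq_integral => t _; rewrite horner_coef -sumEFin; apply: eq_bigr => k _.
rewrite (integral_sum measurableT) => [|k]; last by apply: integrableZl => //;
  exact: integrable_pow.
by apply: eq_bigr => k _; rewrite integralZl ?nu_a //; exact: integrable_pow.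
Qed.

(** Chebyshev: [(B + 1) ^+ n.*2] times the mass of the tail is at most [C * B ^+ n.*2], and the
    ratio of these powers tends to 0. *)
Lemma moment_upper_tail (C B : R) : 0 <= B -> (forall n, a n.*2 <= C * B ^+ n.*2) ->
  nu `]B + 1, +oo[%classic = 0%E.
Proof.
move=> B0 aB; set T := `]B + 1, +oo[%classic : set R.
have mT : measurable (T : set (measurableTypeR R)) by exact: measurable_itv.
have B1 : 0 < B + 1 by rewrite ltr_wpDl.
have nuT : nu T \is a fin_num.
  rewrite ge0_fin_numE //; apply: (@le_lt_trans _ _ (nu setT)); last by rewrite moment_total ltry.
  by apply: le_measure; rewrite ?inE.
have le n : (B + 1) ^+ n.*2 * fine (nu T) <= C * B ^+ n.*2.
  apply: le_trans (aB n); rewrite -lee_fin -nu_a EFinM fineK //.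
  rewrite -(integral_cst _ mT); apply: (@le_trans _ _ (\int[nu]_(t in T) (t ^+ n.*2)%:E)%E).
    apply: ge0_le_integral => //.
    - by move=> t _; rewrite /cst lee_fin.
    - by apply/measurable_EFinP; exact: measurable_funTS.
    - move=> t; rewrite /T /= in_itv /= andbT /cst lee_fin => tB.
      by rewrite lerXn2r // ?nnegrE ltW // (lt_trans B1).
  apply: ge0_subset_integral => //; first exact/measurable_EFinP.
  by move=> t _; rewrite lee_fin.
have q1 : `|(B / (B + 1)) ^+ 2| < 1.
  rewrite ger0_norm ?sqr_ge0 // exprn_ilt1 //; first by rewrite divr_ge0 // ltW.
  by rewrite ltr_pdivrMr // mul1r ltrDl.
have : fine (nu T) <= 0.
  have /cvgr_to_ge := cvg_geometric C q1.
  apply; apply: nearW => n; rewrite /geometric /= -exprM mul2n expr_div_n mulrA.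
  by rewrite ler_pdivlMr ?exprn_gt0 // mulrC.
move=> nu0; rewrite -[nu T]fineK //; congr _%:E; apply/eqP.
by rewrite eq_le nu0 fine_ge0.
Qed.
End OneMeasure.

Lemma msum_moment (nu_ : nat -> {measure set (measurableTypeR R) -> \bar R})
    (a_ : nat -> nat -> R) N n :
  (forall i n, (\int[nu_ i]_t (t ^+ n)%:E)%E = (a_ i n)%:E) ->
  (\int[msum nu_ N]_t (t ^+ n)%:E)%E = (\sum_(i < N) a_ i n)%:E.
Proof.
move=> nu_a; elim: N n => [|N IH] n.
  by rewrite big_ord0 msum_mzero integral_measure_zero.
rewrite (_ : msum nu_ N.+1 = measure_add (msum nu_ N) (nu_ N)); last first.
  by apply/funext => A; rewrite measure_addE /msum/= big_ord_recr.
rewrite integral_measure_add //.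
- by rewrite IH nu_a -EFinD big_ord_recr.
- exact: integrable_pow IH n.
- exact: integrable_pow (nu_a N) n.
Qed.

End Moments.

Lemma Re_sum (R : rcfType) (I : Type) (r : seq I) (P : pred I) (F : I -> R[i]) :
  complex.Re (\sum_(i <- r | P i) F i) = \sum_(i <- r | P i) complex.Re (F i).
Proof. by apply: (big_morph (@complex.Re R)) => // -[a b] [a' b']. Qed.

Section Main.
Variables (R : realType) (G : groupType) (d : nat) (Delta : 'M[group_ring G]_d).
Let A := map_mx (@left_conv R G) Delta.
Hypothesis lfe : locally_finite_embeddable G.
Hypothesis d0 : (0 < d)%N.
Hypotheses (saA : self_adjoint A) (posA : positive_op A).

Let S := sym_supp Delta.
Let D := coef_mx Delta.
Let m n : R := (trace_moment S D n)%:~R.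

Let B : R := (\sum_(g <- S) mx_l1norm (D g))%:~R.

Let B0 : 0 <= B.
Proof. by rewrite ler0z sumr_ge0 // => g _; apply: mx_l1norm_ge0. Qed.

Let m_le n : m n <= d%:R * B ^+ n.
Proof.
apply: le_trans (ler_norm _) _;
  rewrite /m /B -intr_norm -rmorphXn -[d%:R]/(d%:Z%:~R) -rmorphM ler_int.
exact: norm_trace_moment_le.
Qed.

(** The measure is the sum over [i] of the spectral measures at [(i, 1)]. Positivity of [A] clears
    the negative half-line, moment growth clears what exceeds [B + 1], and [moment_ge0] handles
    integrals of polynomials. *)
Lemma spectral_distribution_measure : exists mu : {measure set (measurableTypeR R) -> \bar R},
  [/\ (mu setT < +oo)%E, mu (~` `[0, B + 1]) = 0%E,
      (forall t, spectral_distribution A t = fine (mu `]-oo, t]%classic)) &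
      forall p : {poly R}, 0 <= p.[0] ->
        (forall t : R, t != 0 -> ln (t ^+ 2) <= p.[t]) -> (0 <= \int[mu]_t (p.[t])%:E)%E].
Proof.
have [[E0 specE0]|nospec] := pselect (exists E, is_spectral_measure A E); last first.
  (* The default value of spectral_measure makes the spectral distribution vanish. *)
  exists mzero; split; rewrite /mzero ?ltry //.
    move=> t; rewrite /spectral_distribution /spectral_measure xgetPN; last first.
      by move=> E specE; apply: nospec; exists E.
    by rewrite /mx_trace big1 // => i _; rewrite mxE /vN_trace l2dot0l.
  by move=> p _ _; rewrite integral_measure_zero.
pose E := spectral_measure A.
have specE : is_spectral_measure A E by apply: xgetPex; exists E0.
(* Since [msum] is indexed by natural numbers, indices are read in ['I_d] with default [i0],
   harmless below [d]. *)
pose i0 := Ordinal d0.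
pose nu k := spec_mu specE (insubd i0 k).
pose mu := msum nu d.
have muE C : measurable C -> mu C = (\sum_i complex.Re (vN_trace (E C i i)))%:E.
  move=> mC; rewrite /mu /msum -sumEFin; apply: eq_bigr => i _.
  by rewrite /nu spec_muE // valKd.
have mu_m n : (\int[mu]_t (t ^+ n)%:E)%E = (m n)%:E.
  rewrite (@msum_moment R nu _ d n (fun k n => spec_mu_moment specE (insubd i0 k) n)); congr _%:E.
  under eq_bigr => i _ do rewrite valKd.
  rewrite -Re_sum trace_iter /m -(rmorph_int (real_complex R)).
  by [].
have mN (i : interval R) : measurable ([set` i] : set (measurableTypeR R)) by exact: measurable_itv.
have mu0 : mu `]-oo, 0[%classic = 0%E.
  by rewrite /mu /msum big1 // => i _; rewrite /nu spec_mu_neg.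
have mu_lt0 (C : set (measurableTypeR R)) : measurable C -> C `<=` `]-oo, 0[ -> mu C = 0%E.
  by move=> mC CN; apply: (subset_measure0 mC (mN _) CN mu0).
exists mu; split.
- by rewrite (moment_total mu_m) ltry.
- have -> : ~` `[0, B + 1]%classic = `]-oo, 0[%classic `|` `]B + 1, +oo[%classic :> set R.
    by rewrite setCitv.
  rewrite measureU0 ?mu0 //.
  exact: (moment_upper_tail mu_m B0 (fun n => m_le n.*2)).
- move=> t; rewrite /spectral_distribution /mx_trace Re_sum.
  transitivity (fine (mu `[0, t]%classic)); first by rewrite muE //; exact: measurable_itv.
  (* Passing from [[0, t]] to []-oo, t]] only adds a null set; for [t < 0] both are null. *)
  congr fine; case: (leP 0 t) => t0.
    have -> : `]-oo, t]%classic = `]-oo, 0[%classic `|` `[0, t]%classic :> set R.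
      by rewrite -itv_bndbnd_setU // bnd_simp.
    by rewrite setUC measureU0.
  have -> : `[0, t]%classic = set0 :> set R by rewrite set_itv_ge // bnd_simp -ltNge.
  transitivity (0%E : \bar R); first exact: measure0.
  apply/esym/mu_lt0; first exact: mN.
  by move=> u; rewrite /= !in_itv /= => /le_lt_trans; apply.
- move=> p p0 lnp; rewrite (integral_horner mu_m) lee_fin.
  apply: moment_ge0 => //; first exact: undup_uniq.
    exact: sym_supp_inv.
  exact: (self_adjoint_coef saA).
Qed.

Lemma lndet_ge0 : (0 <= lndet A)%E.
Proof.
have [mu [fin supp FE mu_ln]] := spectral_distribution_measure.
have K1 : 1 <= B + 1 by rewrite lerDr.
rewrite /lndet; have [-> //] := stieltjes_ln_ge0 FE K1 fin supp mu_ln.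
Qed.
End Main.

Theorem determinant_conjecture_lfe (R : realType) (G : groupType) :
  locally_finite_embeddable G -> determinant_conjecture R G.
Proof. by move=> lfe d Delta d0 A sA pA; apply: lndet_ge0. Qed.

(** * Limits of finite marked groups *)

Lemma word_eval_flatten m (G : groupType) (s : 'I_m -> G) (ws : seq (word m)) :
  word_eval s (flatten ws) = (\prod_(w <- ws) word_eval s w)%g.
Proof.
elim: ws => [|w ws IH]; first by rewrite /word_eval !big_nil.
by rewrite big_cons -IH /word_eval /= big_cat.
Qed.

Lemma same_relationsW m (G H : groupType) (s : 'I_m -> G) (t : 'I_m -> H) j k :
  (j <= k)%N -> same_relations k s t -> same_relations j s t.
Proof. by move=> jk st w wj; apply: st; apply: leq_trans jk. Qed.

(** A distance [2 ^- n] below [2 ^- k] means [k < n]. If no length is the last one of agreement,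
    agreement propagates from the empty word to all lengths. *)
Lemma marked_dist_lt (R : realType) m (G H : groupType) (s : 'I_m -> G) (t : 'I_m -> H) k :
  marked_dist R s t < 2 ^- k -> same_relations k s t.
Proof.
rewrite /marked_dist; case: pselect => [e|ne].
  case: (cid e) => n /= [nst _] h; apply: same_relationsW nst.
  move: h; rewrite ltf_pV2 ?posrE ?exprn_gt0 // ltr_eXn2l ?ltr1n //; exact: ltnW.
move=> _; elim: k => [|k IH].
  by case=> // _; rewrite /word_eval !big_nil.
by apply: contrapT => h; apply: ne; exists k.
Qed.

(** Each [g] is written as a word [u g] and sent to its value in [H]. A product of [L] elements of
    [S] becomes a word of length at most [L * N], since [N] bounds every [size (u g)] with [g] in
    [S]. *)
Lemma locally_finite_embeddable_of_relations (G : groupType) m (s : 'I_m -> G) :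
  generates s ->
  (forall k, exists (H : finGroupType) (t : 'I_m -> H), same_relations k s t) ->
  locally_finite_embeddable G.
Proof.
move=> sgen rel S L; have [u uE] := choice sgen.
pose N := (\sum_(g <- S) size (u g))%N.
have [H [t st]] := rel (L * N)%N.
exists H, (fun g => word_eval t (u g)) => w wS wL.
have := st (flatten (map u w)).
rewrite !word_eval_flatten !big_map.
under eq_bigr => g _ do rewrite uE.
apply; rewrite size_flatten /shape -map_comp sumnE big_map.
apply: leq_trans (leq_mul wL (leqnn N)).
elim: w wS {wL} => [|g w IH] wS; first by rewrite big_nil.
rewrite big_cons mulSn leq_add //; last by apply: IH => x xw; apply: wS; rewrite inE xw orbT.
rewrite /N (big_rem g) ?wS ?mem_head //=; exact: leq_addr.
Qed.

Lemma lef_group_locally_finite_embeddable (R : realType) (G : groupType) :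
  lef_group R G -> locally_finite_embeddable G.
Proof.
move=> [m [s [sgen [H [t [_ cvg]]]]]].
apply: (locally_finite_embeddable_of_relations sgen) => k.
have /cvgrPdist_lt/(_ (2 ^- k)) := cvg.
rewrite invr_gt0 exprn_gt0 // => /(_ isT)[n _ /(_ n (leqnn n))].
rewrite sub0r normrN => /(le_lt_trans (ler_norm _))/marked_dist_lt st.
by exists (H n), (t n).
Qed.

(** * The groups SL_2 and PSL_2 *)

Section SL2.
Variable R : comNzRingType.
Implicit Types x y : R * R * R * R.

(** Matrices are quadruples of entries read row by row, so that the group laws reduce to ring
    identities. *)
Definition mx2_det x := let: (a, b, c, d) := x in a * d - b * c.
Definition mx2_mul x y :=
  let: (a, b, c, d) := x in let: (a', b', c', d') := y in
  (a * a' + b * c', a * b' + b * d', c * a' + d * c', c * b' + d * d').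
Definition mx2_adj x := let: (a, b, c, d) := x in (d, - b, - c, a).
Definition mx2_one : R * R * R * R := (1, 0, 0, 1).
Definition mx2_opp x := let: (a, b, c, d) := x in (- a, - b, - c, - d).

Definition sl2 : Type := {x : R * R * R * R | mx2_det x == 1}.

HB.instance Definition _ := Choice.on sl2.
HB.instance Definition _ := [isSub of sl2 for @sval _ _].

Lemma sl2_one_subproof : mx2_det mx2_one == 1.
Proof. by rewrite /= mulr0 subr0 mulr1. Qed.

Lemma sl2_mul_subproof (x y : sl2) : mx2_det (mx2_mul (val x) (val y)) == 1.
Proof.
case: x y => [[[[a b] c] d] /= hx] [[[[a' b'] c'] d'] /= hy].
apply/eqP; rewrite -[RHS]mulr1 -{1}(eqP hx) -(eqP hy); ring.
Qed.

Lemma sl2_inv_subproof (x : sl2) : mx2_det (mx2_adj (val x)) == 1.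
Proof.
case: x => [[[[a b] c] d] /= hx]; apply/eqP; rewrite -(eqP hx); ring.
Qed.

Lemma sl2_opp_subproof (x : sl2) : mx2_det (mx2_opp (val x)) == 1.
Proof.
case: x => [[[[a b] c] d] /= hx]; apply/eqP; rewrite -(eqP hx); ring.
Qed.

Definition sl2_one : sl2 := exist (fun x => is_true (mx2_det x == 1)) mx2_one sl2_one_subproof.
Definition sl2_mul (x y : sl2) : sl2 :=
  exist (fun x => is_true (mx2_det x == 1)) _ (sl2_mul_subproof x y).
Definition sl2_inv (x : sl2) : sl2 :=
  exist (fun x => is_true (mx2_det x == 1)) _ (sl2_inv_subproof x).
Definition sl2_opp (x : sl2) : sl2 :=
  exist (fun x => is_true (mx2_det x == 1)) _ (sl2_opp_subproof x).

Let pairE (a b c d a' b' c' d' : R) :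
  a = a' -> b = b' -> c = c' -> d = d' -> (a, b, c, d) = (a', b', c', d').
Proof. by move=> -> -> -> ->. Qed.

Lemma sl2_mulA : associative sl2_mul.
Proof.
case=> [[[[a b] c] d] /= ?] [[[[a' b'] c'] d'] /= ?] [[[[a'' b''] c''] d''] /= ?].
by apply: val_inj => /=; apply: pairE; ring.
Qed.
Lemma sl2_mul1 : left_id sl2_one sl2_mul.
Proof. by case=> [[[[a b] c] d] ?]; apply: val_inj => /=; apply: pairE; ring. Qed.
Lemma sl2_mulr1 : right_id sl2_one sl2_mul.
Proof. by case=> [[[[a b] c] d] ?]; apply: val_inj => /=; apply: pairE; ring. Qed.
Lemma sl2_mulV : left_inverse sl2_one sl2_inv sl2_mul.
Proof.
case=> [[[[a b] c] d] /= h]; apply: val_inj => /=; apply: pairE; try ring.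
- rewrite -(eqP h); ring.
- rewrite -(eqP h); ring.
Qed.
Lemma sl2_mulrV : right_inverse sl2_one sl2_inv sl2_mul.
Proof.
case=> [[[[a b] c] d] /= h]; apply: val_inj => /=; apply: pairE; try ring.
- rewrite -(eqP h); ring.
- rewrite -(eqP h); ring.
Qed.

HB.instance Definition _ :=
  isGroup.Build sl2 sl2_mulA sl2_mul1 sl2_mulr1 sl2_mulV sl2_mulrV.

End SL2.

HB.instance Definition _ (R : finComNzRingType) := Finite.on (sl2 R).

Section PSL2.
Variable R : comNzRingType.
Implicit Types x y z : sl2 R.

Lemma sl2_oppK x : sl2_opp (sl2_opp x) = x.
Proof. by case: x => [[[[a b] c] d] h]; apply: val_inj; rewrite /= !opprK. Qed.

Lemma sl2_mulNg x y : (sl2_opp x * y = sl2_opp (x * y))%g.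
Proof.
case: x y => [[[[a b] c] d] /= ?] [[[[a' b'] c'] d'] /= ?].
by apply: val_inj => /=; rewrite !mulNr !opprD.
Qed.

Lemma sl2_mulgN x y : (x * sl2_opp y = sl2_opp (x * y))%g.
Proof.
case: x y => [[[[a b] c] d] /= ?] [[[[a' b'] c'] d'] /= ?].
by apply: val_inj => /=; rewrite !mulrN !opprD.
Qed.

Definition sl2_norm x : sl2 R := choose (pred2 x (sl2_opp x)) x.

Lemma sl2_normP x : sl2_norm x = x \/ sl2_norm x = sl2_opp x.
Proof.
have := @chooseP _ (pred2 x (sl2_opp x)) x; rewrite /= eqxx => /(_ isT).
by rewrite -/(sl2_norm x) => /orP[/eqP ->|/eqP ->]; [left|right].
Qed.

Lemma sl2_norm_opp x : sl2_norm (sl2_opp x) = sl2_norm x.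
Proof.
rewrite /sl2_norm (@eq_choose _ _ (pred2 x (sl2_opp x))).
  by apply: choose_id; rewrite /= eqxx ?orbT.
by move=> y; rewrite /= sl2_oppK orbC.
Qed.

Lemma sl2_norm_eq x y : sl2_norm x = sl2_norm y <-> x = y \/ x = sl2_opp y.
Proof.
split=> [|[->|->]] //; last by rewrite sl2_norm_opp.
case: (sl2_normP x) (sl2_normP y) => -> [] ->; first by left.
- by right.
- by move=> <-; right; rewrite sl2_oppK.
- by move=> /(congr1 (@sl2_opp R)); rewrite !sl2_oppK; left.
Qed.

Lemma sl2_norm_idem x : sl2_norm (sl2_norm x) = sl2_norm x.
Proof. by case: (sl2_normP x) => E; rewrite {1}E // sl2_norm_opp. Qed.

Lemma sl2_norm_mull x y : sl2_norm (sl2_norm x * y)%g = sl2_norm (x * y)%g.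
Proof. by case: (sl2_normP x) => ->; rewrite // sl2_mulNg sl2_norm_opp. Qed.

Lemma sl2_norm_mulr x y : sl2_norm (x * sl2_norm y)%g = sl2_norm (x * y)%g.
Proof. by case: (sl2_normP y) => ->; rewrite // sl2_mulgN sl2_norm_opp. Qed.

(* Each class {x, -x} is represented by the canonical choice of one of its elements. *)
Definition psl2 : Type := {x : sl2 R | sl2_norm x == x}.

HB.instance Definition _ := Choice.on psl2.
HB.instance Definition _ := [isSub of psl2 for @sval _ _].

Lemma psl2_of_subproof x : sl2_norm (sl2_norm x) == sl2_norm x.
Proof. by rewrite sl2_norm_idem. Qed.

Definition psl2_of x : psl2 := exist (fun x => is_true (sl2_norm x == x)) _ (psl2_of_subproof x).

Lemma psl2_ofK (g : psl2) : psl2_of (val g) = g.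
Proof. by case: g => x nx; apply: val_inj; apply/eqP. Qed.

Lemma psl2_of_eq x y : psl2_of x = psl2_of y <-> x = y \/ x = sl2_opp y.
Proof.
rewrite -sl2_norm_eq; split=> [/(congr1 val)|h] //.
by apply: val_inj.
Qed.

Definition psl2_mul (g h : psl2) : psl2 := psl2_of (val g * val h)%g.
Definition psl2_inv (g : psl2) : psl2 := psl2_of (val g)^-1%g.

Lemma psl2_mulA : associative psl2_mul.
Proof. by move=> g h k; apply: val_inj; rewrite /= sl2_norm_mulr sl2_norm_mull mulgA. Qed.
Lemma psl2_mul1 : left_id (psl2_of 1%g) psl2_mul.
Proof. by move=> g; rewrite -[RHS]psl2_ofK; apply/psl2_of_eq;
  rewrite -sl2_norm_eq /= sl2_norm_mull mul1g. Qed.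
Lemma psl2_mulr1 : right_id (psl2_of 1%g) psl2_mul.
Proof. by move=> g; rewrite -[RHS]psl2_ofK; apply/psl2_of_eq;
  rewrite -sl2_norm_eq /= sl2_norm_mulr mulg1. Qed.
Lemma psl2_mulV : left_inverse (psl2_of 1%g) psl2_inv psl2_mul.
Proof. by move=> g; apply: val_inj; rewrite /= sl2_norm_mull mulVg. Qed.
Lemma psl2_mulrV : right_inverse (psl2_of 1%g) psl2_inv psl2_mul.
Proof. by move=> g; apply: val_inj; rewrite /= sl2_norm_mulr mulgV. Qed.

HB.instance Definition _ :=
  isGroup.Build psl2 psl2_mulA psl2_mul1 psl2_mulr1 psl2_mulV psl2_mulrV.

Lemma psl2_ofM x y : psl2_of (x * y)%g = (psl2_of x * psl2_of y)%g.
Proof. by apply: val_inj; rewrite /= sl2_norm_mull sl2_norm_mulr. Qed.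

Lemma psl2_of_prod (s : seq (sl2 R)) :
  psl2_of (\prod_(x <- s) x)%g = (\prod_(x <- s) psl2_of x)%g.
Proof. by elim: s => [|x s IH]; rewrite ?big_nil // !big_cons psl2_ofM IH. Qed.

Lemma psl2_ofV x : psl2_of x^-1%g = (psl2_of x)^-1%g.
Proof. by apply: (mulgI (psl2_of x)); rewrite -psl2_ofM !mulgV. Qed.

End PSL2.

HB.instance Definition _ (R : finComNzRingType) := Finite.on (psl2 R).

(** * Nonamenability from an action on the plane *)

Section NotAmenable.
Variables (R : realType) (K : realDomainType).

(** The set [A] and its translates by [a] and [a * a] are disjoint, so [mu A <= 1/3]; but [A] and
    its translate by [b] cover [Q], so [mu A >= 1/2]. The signs [e] make room for matrices known
    only up to sign. *)
Lemma not_amenable_plane (Q : groupType) (f : Q -> K * K) (a b : Q) :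
  (forall q, f q <> (0, 0)) ->
  (forall q, exists e : bool, f (a * q)%g =
    ((-1) ^+ e * ((f q).1 + 3 * (f q).2), (-1) ^+ e * (f q).2)) ->
  (forall q, exists e : bool, f (b * q)%g = ((-1) ^+ e * - (f q).2, (-1) ^+ e * (f q).1)) ->
  ~ amenable R Q.
Proof.
move=> f0 fa fb [mu [mu1 mu_ge0 muU mu_inv]].
have mu_sub (A B : set Q) : (A `<=` B)%classic -> mu A <= mu B.
  move=> AB; rewrite -(setDUK AB) muU ?lerDl //.
  by rewrite setDIK.
pose A := [set q | `|(f q).1| <= `|(f q).2| ]%classic.
pose tr g := [set (g * h)%g | h in A]%classic.
have norm_a q : `|(f (a * q)%g).2| = `|(f q).2|.
  by have [e ->] := fa q; rewrite /= normrMsign.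
have A_ne q : A q -> (f q).2 != 0.
  move=> Aq; apply/eqP => f2; apply: (f0 q); move: Aq; rewrite /A /= f2 normr0 normr_le0 => /eqP f1.
  by rewrite [LHS]surjective_pairing f1 f2.
(* From [|x| <= |y|] and [|x + 3 y| <= |y|] would follow [3 |y| <= 2 |y|], whereas [y != 0]. *)
have disj1 : (A `&` tr a = set0)%classic.
  apply/seteqP; split=> // q [Aq [h Ah hq]]; have := A_ne h Ah.
  move: Aq Ah; rewrite /A /= -hq; have [e ->] := fa h; rewrite /= !normrMsign.
  case: (f h) => x y /=; rewrite -normr_gt0 => h1 h2 h3.
  have := ler_normB (x + 3 * y) x; rewrite addrAC subrr add0r normrM.
  rewrite (ger0_norm (ler0n _ 3)); lra.
have disj2 : (A `&` tr (a * a)%g = set0)%classic.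
  apply/seteqP; split=> // q [Aq [h Ah hq]]; have := A_ne h Ah.
  move: Aq Ah; rewrite /A /= -hq -mulgA; have [e ->] := fa (a * h)%g; have [e' ->] := fa h.
  rewrite /= !normrMsign mulrCA -mulrDr normrMsign.
  case: (f h) => x y /=; rewrite -normr_gt0 => h1 h2 h3.
  have := ler_normB (x + 3 * y + 3 * y) x.
  have -> : x + 3 * y + 3 * y - x = 6 * y by ring.
  rewrite normrM (ger0_norm (ler0n _ 6)); lra.
have disj3 : ((A `|` tr a) `&` tr (a * a)%g = set0)%classic.
  rewrite setIUl disj2 set0U; apply/seteqP; split=> // q [[h Ah hq] [h' Ah' hq']].
  suff : (A `&` tr a)%classic h by rewrite disj1.
  by split=> //; exists h' => //; apply: (mulgI a); rewrite hq -hq' mulgA.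
have muA : mu A + mu A + mu A <= 1.
  rewrite -{2}(mu_inv a A) -{2}(mu_inv (a * a)%g A) -!muU // -mu1.
  exact: mu_sub.
have : mu setT <= mu (A `|` tr b)%classic.
  apply: mu_sub => q _; case: (leP `|(f q).1| `|(f q).2|) => h; [by left|right].
  exists (b^-1 * q)%g; last by rewrite mulKVg.
  have [e] := fb (b^-1 * q)%g; rewrite mulKVg => fq.
  by move: h; rewrite fq /A /= !normrMsign normrN => /ltW.
have -> : (A `|` tr b = A `|` (tr b `\` A))%classic.
  apply/seteqP; split=> q; last by case=> [|[]]; [left|right].
  by case=> [|h]; [left|case: (pselect (A q)); [left|right]].
rewrite muU ?setDIK // mu1; have := mu_sub (tr b `\` A)%classic (tr b) (@subDsetl _ _ _).
rewrite (mu_inv b A); lra.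
Qed.
End NotAmenable.

Section Elementary.
Variable R : comNzRingType.

Definition sl2_mk (a b c d : R) (h : mx2_det (a, b, c, d) == 1) : sl2 R :=
  exist (fun x => is_true (mx2_det x == 1)) (a, b, c, d) h.

Lemma sl2_up_subproof (s : R) : mx2_det (1, s, 0, 1) == 1.
Proof. by rewrite /= mulr1 mulr0 subr0. Qed.
Lemma sl2_rot_subproof : mx2_det (0, -1, 1, 0 : R) == 1.
Proof. by rewrite /= mul0r sub0r mulr1 opprK. Qed.

Definition sl2_up s := sl2_mk (sl2_up_subproof s).
Definition sl2_rot := sl2_mk sl2_rot_subproof.

End Elementary.

(** * Simplicity of PSL_2 over a field *)

Section Simplicity.
Variable F : fieldType.
Variable u : F.
Hypotheses (u0 : u != 0) (u4 : u ^+ 4 != 1).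

Variable N : sl2 F -> Prop.
Hypothesis NM : forall x y, N x -> N y -> N (x * y)%g.
Hypothesis NV : forall x, N x -> N (x^-1)%g.
Hypothesis NJ : forall x y, N x -> N (x ^ y)%g.

Let M (a b c d : F) : Prop := exists2 x, N x & val x = (a, b, c, d).

Let M_det a b c d : M a b c d -> a * d - b * c = 1.
Proof. by case=> [[x h] _ /= xE]; move: h; rewrite xE => /eqP. Qed.

Let M_mul a b c d a' b' c' d' : M a b c d -> M a' b' c' d' ->
  M (a * a' + b * c') (a * b' + b * d') (c * a' + d * c') (c * b' + d * d').
Proof. by move=> [x Nx xE] [y Ny yE]; exists (x * y)%g; [exact: NM|rewrite /= xE yE]. Qed.

Let M_inv a b c d : M a b c d -> M d (- b) (- c) a.
Proof. by move=> [x Nx xE]; exists (x^-1)%g; [exact: NV|rewrite /= xE]. Qed.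

Let M_eq a b c d a' b' c' d' : M a b c d -> a = a' -> b = b' -> c = c' -> d = d' -> M a' b' c' d'.
Proof. by move=> h <- <- <- <-. Qed.

(* Conjugation of (a, b; c, d) to (s, -q; -r, p)(a, b; c, d)(p, q; r, s). *)
Let M_conj p q r s a b c d : p * s - q * r = 1 -> M a b c d ->
  M (s * (a * p + b * r) - q * (c * p + d * r)) (s * (a * q + b * s) - q * (c * q + d * s))
    (p * (c * p + d * r) - r * (a * p + b * r)) (p * (c * q + d * s) - r * (a * q + b * s)).
Proof.
move=> h [x Nx xE]; have h' : mx2_det (p, q, r, s) == 1 by apply/eqP.
exists (x ^ sl2_mk h')%g; first exact: NJ.
by rewrite /= xE; congr (_, _, _, _); ring.
Qed.

(** Rotation exchanges the off-diagonal entries up to sign. A diagonal matrix conjugated by (1, 1;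
    0, 1) acquires the entry [a - d], which is nonzero unless the matrix is 1 or -1. *)
Let M_low_left a b c d : M a b c d -> (a, b, c, d) != (1, 0, 0, 1) ->
  (a, b, c, d) != (-1, 0, 0, -1) -> exists a' b' c' d', M a' b' c' d' /\ c' != 0.
Proof.
move=> Mx x1 xN1; have [c0|] := eqVneq c 0; last by exists a, b, c, d.
have lower a' b' c' d' : M a' b' c' d' -> b' != 0 -> exists a' b' c' d', M a' b' c' d' /\ c' != 0.
  move=> My b0; exists d', (- c'), (- b'), a'; split; last by rewrite oppr_eq0.
  have h : 0 * 0 - (-1) * 1 = 1 :> F by ring.
  by apply: (M_eq (M_conj h My)); ring.
have [b0|b0] := eqVneq b 0; last exact: lower Mx b0.
have det := M_det Mx; have h : 1 * 1 - 1 * 0 = 1 :> F by ring.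
apply: (lower _ _ _ _ (M_conj h Mx)).
have -> : 1 * (a * 1 + b * 1) - 1 * (c * 1 + d * 1) = a - d by rewrite b0 c0; ring.
rewrite subr_eq0; apply: contra x1 => /eqP ad.
have : (a - 1) * (a + 1) = 0.
  have -> : (a - 1) * (a + 1) = (a * a - 0 * 0) - 1 by ring.
  by move: det; rewrite b0 c0 -ad => ->; rewrite subrr.
move/eqP; rewrite mulf_eq0 subr_eq0 addr_eq0 => /orP[] /eqP a1; first by rewrite -ad a1 b0 c0.
by case/negP: xN1; rewrite -ad a1 b0 c0.
Qed.

(** An upper unipotent conjugation clears the upper left entry. The commutator with a diagonal
    matrix in [u] is then lower triangular with diagonal [u ^+ 2], [u ^- 2], and its commutator with
    a lower unipotent matrix is lower unipotent with entry [r * (u ^- 4 - 1)], any prescribed [s] as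
    [u ^+ 4 != 1]. *)
Let M_low_all a b c d : M a b c d -> c != 0 -> forall s, M 1 0 s 1.
Proof.
move=> Mx c0.
have det := M_det Mx.
have h1 : 1 * 1 - (a / c) * 0 = 1 by ring.
have M1 : M 0 (- c^-1) c (a + d).
  have bE : b = (a * d - 1) / c by rewrite -det; field.
  by apply: (M_eq (M_conj h1 Mx)); rewrite ?bE; field.
have hu : u^-1 * u - 0 * 0 = 1 by field.
have M2 : M (u ^+ 2) 0 (c * (a + d) * (u ^- 2 - 1)) (u ^- 2).
  by apply: (M_eq (M_mul (M_conj hu M1) (M_inv M1))); field; rewrite ?u0 ?c0.
set k := c * (a + d) * _ in M2.
move=> s; pose r := s / (u ^- 4 - 1).
have u4' : u ^- 4 - 1 != 0.
  by rewrite subr_eq0 -[1]invr1 (inj_eq invr_inj).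
have u4'' : 1 - u ^+ 4 != 0 by rewrite subr_eq0 eq_sym.
have hr : 1 * 1 - 0 * r = 1 by ring.
apply: (M_eq (M_mul (M_conj hr M2) (M_inv M2))); rewrite /r; field;
  rewrite ?u0 //= mulN1r u4'' ?andbT //.
Qed.

(** Rotation turns lower unipotents into upper ones. A matrix with [r != 0] is a product upper,
    lower, upper; if [r = 0], adding the second column to the first leads back to that case. *)
Lemma sl2_normal_full x : N x -> x <> 1%g -> x <> sl2_opp 1%g -> forall y, N y.
Proof.
move=> Nx x1 xN1.
case xE : (val x) => [[[a b] c] d].
have Mx : M a b c d by exists x.
have [||a' [b' [c' [d' [My c0]]]]] := M_low_left Mx.
- by apply/eqP => e; apply: x1; apply: val_inj; rewrite xE e.
- by apply/eqP => e; apply: xN1; apply: val_inj; rewrite xE e /= oppr0.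
have low := M_low_all My c0.
have up s : M 1 s 0 1.
  have h : 0 * 0 - (-1) * 1 = 1 :> F by ring.
  by apply: (M_eq (M_conj h (low (- s)))); ring.
have full p q r t : p * t - q * r = 1 -> r != 0 -> M p q r t.
  move=> det r0.
  apply: (M_eq (M_mul (M_mul (up ((p - 1) / r)) (low r)) (up ((t - 1) / r)))); try by field.
  have -> : q = (p * t - 1) / r by rewrite -det; field.
  by field.
move=> y; case yE : (val y) => [[[p q] r] t].
have det : p * t - q * r = 1 by apply/eqP; have := valP y; rewrite yE.
suff [z Nz zE] : M p q r t by rewrite (_ : y = z) //; apply: val_inj; rewrite zE.
have [r0|] := eqVneq r 0; last exact: full.
have t0 : t != 0.
  by apply/eqP => t0; move: det; rewrite r0 t0 !mulr0 subr0 => /esym/eqP; rewrite oner_eq0.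
have det' : (p + q) * t - q * t = 1 by rewrite -det r0; ring.
by apply: (M_eq (M_mul (full (p + q) q t t det' t0) (low (-1)))); rewrite ?r0; ring.
Qed.
End Simplicity.

Lemma psl2_simple (F : fieldType) (u : F) : u != 0 -> u ^+ 4 != 1 -> simple_group (psl2 F).
Proof.
move=> u0 u4; split.
  exists (psl2_of (sl2_up 1)) => /psl2_of_eq[] /(congr1 (fun x => (val x).1.1.2)) /= /eqP.
    by rewrite oner_eq0.
  by rewrite oppr0 oner_eq0.
move=> N N1 NM NV NJ.
pose N' x := N (psl2_of x).
have [ex|nex] := pselect (exists x, [/\ N' x, x <> 1%g & x <> sl2_opp 1%g]).
  have [x [Nx x1 xN1]] := ex; right; apply/seteqP; split=> // g _.
  rewrite -(psl2_ofK g); apply: (sl2_normal_full u0 u4 _ _ _ Nx x1 xN1).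
  - by move=> y z Ny Nz; rewrite /N' psl2_ofM; exact: NM.
  - by move=> y Ny; rewrite /N' psl2_ofV; exact: NV.
  - by move=> y z Ny; rewrite /N' /conjg !psl2_ofM psl2_ofV; exact: NJ.
left; apply/seteqP; split=> [g Ng|g ->] //=.
rewrite -(psl2_ofK g); apply/psl2_of_eq.
apply: contrapT => /not_orP[h1 h2]; apply: nex; exists (val g); split=> //.
by rewrite /N' psl2_ofK.
Qed.

(** * Reduction of rational matrices modulo a prime *)

Section RationalReduction.
Variable p : nat.
Hypothesis p_pr : prime p.

Lemma intr_Fp_eq0 (n : int) : (n%:~R == 0 :> 'F_p) = (p %| `|n|)%N.
Proof.
have E : (p %| `|n|)%N = (`|n|%:R == 0 :> 'F_p).
  exact: (dvdn_pcharf (pchar_Fp p_pr)).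
by rewrite E {1}[n]intEsign rmorphM /= rmorphXn /= rmorphN1 mulr_sign; case: (n < 0)%R;
  rewrite ?oppr_eq0.
Qed.

Definition rat_mod (x : rat) : 'F_p := (numq x)%:~R / (denq x)%:~R.
Definition p_integral (x : rat) : bool := (denq x)%:~R != 0 :> 'F_p.

(** Cross multiplication modulo [p]: were [denq x] zero there, [numq x] would be too, against
    coprimality. Unreduced fractions are allowed so as to treat sums and products directly. *)
Lemma rat_mod_frac (n d : int) : d%:~R != 0 :> 'F_p ->
  p_integral (n%:~R / d%:~R) /\ rat_mod (n%:~R / d%:~R) = n%:~R / d%:~R.
Proof.
move=> dp; set x := n%:~R / d%:~R.
have d0 : d%:~R != 0 :> rat by rewrite intr_eq0; apply: contra dp => /eqP ->.
have e : numq x * d = n * denq x.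
  apply/eqP; rewrite -(eqr_int rat) !rmorphM /= numqE /x mulrAC divfK //.
have e' : (numq x)%:~R * d%:~R = n%:~R * (denq x)%:~R :> 'F_p by rewrite -!rmorphM e.
have xp : p_integral x.
  apply/negP => /eqP h; move: e'; rewrite h mulr0 => /eqP; rewrite mulf_eq0 (negPf dp) orbF.
  move: h => /eqP; rewrite !intr_Fp_eq0 => pd pn.
  have := coprime_num_den x; rewrite /coprime => /eqP g1.
  have : (p %| 1)%N by rewrite -g1 dvdn_gcd pn pd.
  by rewrite dvdn1 => /eqP p1; move: p_pr; rewrite p1.
split=> //; apply: (mulIf xp); apply: (mulIf dp).
by rewrite /rat_mod divfK // e' mulrAC divfK.
Qed.

Lemma p_integralN (x : rat) : p_integral (- x) = p_integral x.
Proof. by rewrite /p_integral denqN. Qed.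

Let fracD (x y : rat) : x + y = (numq x * denq y + numq y * denq x)%:~R / (denq x * denq y)%:~R.
Proof.
rewrite -{1}[x]divq_num_den -{1}[y]divq_num_den addf_div ?intr_eq0 ?denq_neq0 //.
by rewrite !rmorphD !rmorphM.
Qed.

Let fracM (x y : rat) : x * y = (numq x * numq y)%:~R / (denq x * denq y)%:~R.
Proof. by rewrite -{1}[x]divq_num_den -{1}[y]divq_num_den mulf_div !rmorphM. Qed.

Let den2 x y : p_integral x -> p_integral y -> (denq x * denq y)%:~R != 0 :> 'F_p.
Proof. by move=> hx hy; rewrite rmorphM mulf_neq0. Qed.

Lemma rat_modD x y : p_integral x -> p_integral y ->
  p_integral (x + y) /\ rat_mod (x + y) = rat_mod x + rat_mod y.
Proof.
move=> hx hy; rewrite fracD;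
  have [h ->] := rat_mod_frac (numq x * denq y + numq y * denq x) (den2 hx hy).
by split=> //; rewrite /rat_mod addf_div // rmorphD !rmorphM.
Qed.

Lemma rat_modM x y : p_integral x -> p_integral y ->
  p_integral (x * y) /\ rat_mod (x * y) = rat_mod x * rat_mod y.
Proof.
move=> hx hy; rewrite fracM; have [h ->] := rat_mod_frac (numq x * numq y) (den2 hx hy).
by split=> //; rewrite /rat_mod mulf_div !rmorphM.
Qed.

Lemma rat_modN x : rat_mod (- x) = - rat_mod x.
Proof. by rewrite /rat_mod numqN denqN rmorphN mulNr. Qed.

Lemma p_integral_int (n : int) : p_integral n%:~R /\ rat_mod n%:~R = n%:~R.
Proof.
have h : (1 : int)%:~R != 0 :> 'F_p by rewrite oner_eq0.
by have := rat_mod_frac n h; rewrite !divr1.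
Qed.

Lemma rat_mod_eq0 (x : rat) : p_integral x -> (x != 0 -> (numq x)%:~R != 0 :> 'F_p) ->
  rat_mod x = 0 -> x = 0.
Proof.
move=> hx h /eqP; rewrite mulf_eq0 invr_eq0 (negPf hx) orbF => n0.
by apply/eqP/contraT => /h; rewrite n0.
Qed.

Definition mx2_int (x : rat * rat * rat * rat) : bool :=
  let: (a, b, c, d) := x in [&& p_integral a, p_integral b, p_integral c & p_integral d].
Definition mx2_mod (x : rat * rat * rat * rat) : 'F_p * 'F_p * 'F_p * 'F_p :=
  let: (a, b, c, d) := x in (rat_mod a, rat_mod b, rat_mod c, rat_mod d).

Lemma mx2_mod_mul x y : mx2_int x -> mx2_int y ->
  mx2_mod (mx2_mul x y) = mx2_mul (mx2_mod x) (mx2_mod y).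
Proof.
case: x y => [[[a b] c] d] [[[a' b'] c'] d'] /and4P[ia ib ic id] /and4P[ia' ib' ic' id'] /=.
have dot x y z t : p_integral x -> p_integral y -> p_integral z -> p_integral t ->
    rat_mod (x * y + z * t) = rat_mod x * rat_mod y + rat_mod z * rat_mod t.
  move=> hx hy hz ht; have [h1 <-] := rat_modM hx hy; have [h2 <-] := rat_modM hz ht.
  by have [] := rat_modD h1 h2.
by rewrite !dot.
Qed.

Lemma mx2_mod_det x : mx2_int x -> mx2_det (mx2_mod x) = rat_mod (mx2_det x).
Proof.
case: x => [[[a b] c] d] /and4P[ia ib ic id] /=.
have [h1 <-] := rat_modM ia id; have [h2 <-] := rat_modM ib ic.
rewrite -rat_modN; have [|_ ->] // := rat_modD h1 (y := - (b * c)).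
by rewrite p_integralN.
Qed.

(** The default 1 is reached only if the reduced determinant is not 1, which p-integral entries
    exclude. *)
Definition sl2_mod (x : sl2 rat) : sl2 'F_p := insubd (1%g : sl2 'F_p) (mx2_mod (val x)).

Lemma val_sl2_mod x : mx2_int (val x) -> val (sl2_mod x) = mx2_mod (val x).
Proof.
move=> ix; rewrite val_insubd mx2_mod_det // (eqP (valP x)).
by have [_ ->] := p_integral_int 1; rewrite eqxx.
Qed.

Lemma sl2_modM (x y : sl2 rat) : mx2_int (val x) -> mx2_int (val y) -> mx2_int (val (x * y)%g) ->
  sl2_mod (x * y)%g = (sl2_mod x * sl2_mod y)%g.
Proof.
move=> ix iy ixy; apply: val_inj; rewrite val_sl2_mod //= !val_sl2_mod //.
exact: mx2_mod_mul.
Qed.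

Lemma pair4_inj (T : Type) (a b c d a' b' c' d' : T) :
  (a, b, c, d) = (a', b', c', d') -> [/\ a = a', b = b', c = c' & d = d'].
Proof. by case=> -> -> -> ->. Qed.

(** The numbers whose vanishing decides whether [x] is 1 or -1, together with the remaining diagonal
    entries; if reduction preserves their being nonzero, it detects triviality in PSL_2. *)
Definition entries (x : sl2 rat) : seq rat :=
  let: (a, b, c, d) := val x in [:: a; b; c; d; a - 1; a + 1; d - 1; d + 1].

Lemma sl2_mod_pm1 (x : sl2 rat) :
  (forall e, e \in entries x -> p_integral e && ((e != 0) ==> ((numq e)%:~R != 0 :> 'F_p))) ->
  mx2_int (val x) /\
  (psl2_of (sl2_mod x) = 1%g <-> psl2_of x = 1%g).
Proof.
rewrite /entries; move: (@val_sl2_mod x); case xE : (val x) => [[[a b] c] d] modE h.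
have H e : e \in [:: a; b; c; d; a - 1; a + 1; d - 1;
  d + 1] -> p_integral e /\ (rat_mod e = 0 -> e = 0).
  by move=> /h/andP[h1 h2]; split=> //; apply: rat_mod_eq0 => //; apply/implyP.
have [ia _] := H a (mem_head _ _).
have [ib zb] := H b ltac:(by rewrite !inE eqxx ?orbT).
have [ic zc] := H c ltac:(by rewrite !inE eqxx ?orbT).
have [id _] := H d ltac:(by rewrite !inE eqxx ?orbT).
have [_ za1] := H (a - 1) ltac:(by rewrite !inE eqxx ?orbT).
have [_ za2] := H (a + 1) ltac:(by rewrite !inE eqxx ?orbT).
have [_ zd1] := H (d - 1) ltac:(by rewrite !inE eqxx ?orbT).
have [_ zd2] := H (d + 1) ltac:(by rewrite !inE eqxx ?orbT).
have int1 := p_integral_int 1; have intN1 := p_integral_int (-1).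
have r1 : rat_mod 1 = 1 by have [_] := int1.
have r0 : rat_mod 0 = 0 by have [_] := p_integral_int 0.
have modB1 e : p_integral e -> rat_mod (e - 1) = rat_mod e - 1.
  by move=> ie; have [_ ->] := rat_modD ie intN1.1; rewrite intN1.2.
have modD1 e : p_integral e -> rat_mod (e + 1) = rat_mod e + 1.
  by move=> ie; have [_ ->] := rat_modD ie int1.1; rewrite int1.2.
have ix : mx2_int (a, b, c, d) by rewrite /= ia ib ic id.
split=> //.
have mE := modE ix.
have -> : (1%g : psl2 rat) = psl2_of 1%g by [].
have -> : (1%g : psl2 'F_p) = psl2_of 1%g by [].
rewrite !psl2_of_eq; split=> -[/(congr1 val)|/(congr1 val)].
- rewrite mE => e; have [ea eb ec ed] := @pair4_inj 'F_p _ _ _ _ 1 0 0 1 e; left; apply: val_inj;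
    rewrite xE.
  have /eqP : a - 1 = 0 by apply: za1; rewrite modB1 // ea subrr.
  have /eqP : d - 1 = 0 by apply: zd1; rewrite modB1 // ed subrr.
  by rewrite !subr_eq0 zb // zc // => /eqP -> /eqP ->.
- rewrite mE => e; have [ea eb ec ed] := @pair4_inj 'F_p _ _ _ _ (-1) (-0) (-0) (-1) e; right;
    apply: val_inj; rewrite xE.
  have /eqP : a + 1 = 0 by apply: za2; rewrite modD1 // ea addNr.
  have /eqP : d + 1 = 0 by apply: zd2; rewrite modD1 // ed addNr.
  rewrite !addr_eq0 zb ?eb ?oppr0 // zc ?ec ?oppr0 // => /eqP -> /eqP ->.
  by rewrite /= !oppr0.
- rewrite xE => e; have [ea eb ec ed] := @pair4_inj rat _ _ _ _ 1 0 0 1 e; left; apply: val_inj;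
    rewrite mE /mx2_mod ea eb ec ed.
  by rewrite r1 r0.
- rewrite xE => e; have [ea eb ec ed] := @pair4_inj rat _ _ _ _ (-1) (-0) (-0) (-1) e; right;
    apply: val_inj; rewrite mE /mx2_mod ea eb ec ed.
  by rewrite !rat_modN r1 r0.
Qed.

End RationalReduction.

Lemma mem_words (T : eqType) (S : seq T) w : {subset w <= S} -> w \in words S (size w).
Proof.
elim: w => [|g w IH] wS //=.
apply/allpairsP; exists (g, w); split=> //=; first by apply: wS; rewrite mem_head.
by apply: IH => x xw; apply: wS; rewrite inE xw orbT.
Qed.

Definition words_le (T : Type) (S : seq T) L : seq (seq T) :=
  flatten [seq words S k | k <- iota 0 L.+1].

Lemma mem_words_le (T : eqType) (S : seq T) L w :
  {subset w <= S} -> (size w <= L)%N -> w \in words_le S L.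
Proof.
move=> wS wL; apply/flattenP; exists (words S (size w)); last exact: mem_words.
by apply/mapP; exists (size w); rewrite // mem_iota.
Qed.

(** All words of length at most [L] are multiplied out in [sl2 rat]. A prime above the numerators
    and denominators of all resulting [entries] divides no denominator and no nonzero numerator. *)
Lemma psl2_rat_locally_finite_embeddable : locally_finite_embeddable (psl2 rat).
Proof.
move=> S L.
pose P (w : seq (psl2 rat)) : sl2 rat := (\prod_(g <- w) val g)%g.
pose Es := flatten [seq entries (P w) | w <- words_le S L].
have [p] := prime_above (\sum_(e <- Es) (`|numq e| + `|denq e|))%N.
move=> p_gt p_pr.
exists (psl2 'F_p), (fun g => psl2_of (sl2_mod p (val g))).
have EsP e : e \in Es -> p_integral p e && ((e != 0) ==> ((numq e)%:~R != 0 :> 'F_p)).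
  move=> eE; have lt : (`|numq e| + `|denq e| < p)%N.
    by apply: leq_ltn_trans p_gt; rewrite (big_rem e) //= leq_addr.
  apply/andP; split.
    rewrite /p_integral intr_Fp_eq0 //; apply/negP => /dvdn_leq.
    by rewrite absz_gt0 denq_neq0 => /(_ isT); lia.
  apply/implyP => e0; rewrite intr_Fp_eq0 //; apply/negP => /dvdn_leq.
  by rewrite absz_gt0 numq_eq0 e0 => /(_ isT); lia.
have ok w : {subset w <= S} -> (size w <= L)%N ->
    mx2_int p (val (P w)) /\ (psl2_of (sl2_mod p (P w)) = 1%g <-> psl2_of (P w) = 1%g).
  move=> wS wL; apply: sl2_mod_pm1 => // e eP; apply: EsP.
  by apply/flattenP; exists (entries (P w)) => //; apply/mapP; exists w => //; exact: mem_words_le.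
move=> w wS wL.
have -> : (\prod_(g <- w) g)%g = psl2_of (P w).
  rewrite /P -(big_map val xpredT id) psl2_of_prod big_map.
  by apply: eq_bigr => g _; rewrite psl2_ofK.
(* Reduction is multiplicative only on p-integral matrices; [ok] supplies integrality for the
   letter, the tail and the whole word. *)
have -> : (\prod_(g <- w) psl2_of (sl2_mod p (val g)))%g = psl2_of (sl2_mod p (P w)).
  elim: w wS wL => [|g w IH] wS wL.
    have [i1 _] := ok [::] wS isT.
    rewrite big_nil; congr psl2_of; apply: val_inj; rewrite val_sl2_mod // /P big_nil /=.
    have [_ r1] := p_integral_int p_pr 1; have [_ r0] := p_integral_int p_pr 0.
    by rewrite (r1 : rat_mod p 1 = 1) (r0 : rat_mod p 0 = 0).
  have wS' : {subset w <= S} by move=> x xw; apply: wS; rewrite inE xw orbT.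
  have gS : {subset [:: g] <= S} by move=> x; rewrite inE => /eqP ->; apply: wS; rewrite mem_head.
  have L0 : (0 < L)%N by apply: leq_trans wL.
  rewrite big_cons IH // 1?ltnW // -psl2_ofM; congr psl2_of.
  have [ig _] := ok _ gS L0; have [iw _] := ok _ wS' (ltnW wL); have [igw _] := ok _ wS wL.
  have Pg : P [:: g] = val g by rewrite /P big_seq1.
  have Pgw : P (g :: w) = (val g * P w)%g by rewrite /P big_cons.
  rewrite Pg in ig; rewrite Pgw in igw *; by rewrite (sl2_modM p_pr ig iw igw).
by have [_ ->] := ok w wS wL.
Qed.

(** The map to the plane is the first column of the chosen representative; representatives multiply
    up to a sign, recorded by [e]. *)
Lemma psl2_rat_not_amenable (R : realType) : ~ amenable R (psl2 rat).
Proof.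
pose f (g : psl2 rat) : rat * rat := ((val (val g)).1.1.1, (val (val g)).1.2).
have mulE (x : sl2 rat) (g : psl2 rat) : exists e : bool,
    f (psl2_of x * g)%g = ((-1) ^+ e * (val (x * val g)%g).1.1.1,
      (-1) ^+ e * (val (x * val g)%g).1.2).
  have -> : (psl2_of x * g)%g = psl2_of (x * val g)%g by rewrite -{1}[g]psl2_ofK psl2_ofM.
  move: (x * val g)%g => y; have vE : val (psl2_of y) = sl2_norm y by [].
  rewrite /f vE; case: (sl2_normP y) => ->; first by exists false; rewrite !mul1r.
  by exists true; rewrite !mulN1r; case: y {vE} => [[[[a b] c] d] h].
apply: (@not_amenable_plane R rat _ f (psl2_of (sl2_up 3)) (psl2_of (sl2_rot _))).
- move=> g; have := valP (val g); rewrite /f; case: (val (val g)) => [[[a b] c] d] /= h [a0 c0].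
  by move: h; rewrite a0 c0 mul0r mulr0 subrr eq_sym oner_eq0.
- move=> g; have [e ->] := mulE (sl2_up 3) g; exists e; rewrite /f /=.
  by case: (val (val g)) => [[[a b] c] d] /=; rewrite !mul1r mul0r add0r.
- move=> g; have [e ->] := mulE (sl2_rot _) g; exists e; rewrite /f /=.
  by case: (val (val g)) => [[[a b] c] d] /=; rewrite !mul1r !mul0r add0r addr0 mulN1r.
Qed.

HB.instance Definition _ := Countable.on (sl2 rat).
HB.instance Definition _ := Countable.on (psl2 rat).
Lemma psl2_rat_countable : countable [set: psl2 rat].
Proof. exact: countableP. Qed.

(** * Lamplighter groups *)

Section GeneratedSubgroup.
Variables (G : groupType) (m : nat) (s : 'I_m -> G).

Lemma word_eval_cat (v w : word m) : word_eval s (v ++ w) = (word_eval s v * word_eval s w)%g.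
Proof. by rewrite /word_eval big_cat. Qed.

Definition word_inv (w : word m) : word m := rev [seq (l.1, ~~ l.2) | l <- w].

Lemma word_eval_inv (w : word m) : word_eval s (word_inv w) = (word_eval s w)^-1%g.
Proof.
elim: w => [|l w IH]; first by rewrite /word_eval !big_nil invg1.
rewrite /word_inv /= rev_cons -cats1 word_eval_cat -/(word_inv w) IH.
rewrite /word_eval [in RHS]big_cons big_seq1 invMg; congr (_ * _)%g.
by case: l => i [] //=; rewrite invgK.
Qed.

Definition generated_subgroup : Type := {g : G | `[< exists w, word_eval s w = g >]}.

HB.instance Definition _ := Choice.on generated_subgroup.
HB.instance Definition _ := [isSub of generated_subgroup for @sval _ _].

Definition gen_sub g (h : exists w, word_eval s w = g) : generated_subgroup :=
  exist (fun g => is_true `[< exists w, word_eval s w = g >]) g (asboolT h).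

Lemma gen_ex (x : generated_subgroup) : exists w, word_eval s w = val x.
Proof. exact/asboolP/(valP x). Qed.

Lemma gen_one_subproof : exists w, word_eval s w = 1%g.
Proof. by exists [::]; rewrite /word_eval big_nil. Qed.
Lemma gen_mul_subproof (x y : generated_subgroup) :
  exists w, word_eval s w = (val x * val y)%g.
Proof.
by have [v <-] := gen_ex x; have [w <-] := gen_ex y; exists (v ++ w); rewrite word_eval_cat.
Qed.
Lemma gen_inv_subproof (x : generated_subgroup) : exists w, word_eval s w = (val x)^-1%g.
Proof. by have [v <-] := gen_ex x; exists (word_inv v); rewrite word_eval_inv. Qed.

Definition gen_one := gen_sub gen_one_subproof.
Definition gen_mul x y := gen_sub (gen_mul_subproof x y).
Definition gen_inv x := gen_sub (gen_inv_subproof x).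

Lemma gen_mulA : associative gen_mul.
Proof. by move=> x y z; apply: val_inj; rewrite /= mulgA. Qed.
Lemma gen_mul1 : left_id gen_one gen_mul.
Proof. by move=> x; apply: val_inj; rewrite /= mul1g. Qed.
Lemma gen_mulr1 : right_id gen_one gen_mul.
Proof. by move=> x; apply: val_inj; rewrite /= mulg1. Qed.
Lemma gen_mulV : left_inverse gen_one gen_inv gen_mul.
Proof. by move=> x; apply: val_inj; rewrite /= mulVg. Qed.
Lemma gen_mulrV : right_inverse gen_one gen_inv gen_mul.
Proof. by move=> x; apply: val_inj; rewrite /= mulgV. Qed.

HB.instance Definition _ := isGroup.Build generated_subgroup
  gen_mulA gen_mul1 gen_mulr1 gen_mulV gen_mulrV.

Lemma gen_gen_subproof i : exists w, word_eval s w = s i.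
Proof. by exists [:: (i, true)]; rewrite /word_eval big_seq1. Qed.

Definition gen_gen i : generated_subgroup := gen_sub (gen_gen_subproof i).

Lemma val_word_eval_gen (w : word m) : val (word_eval gen_gen w) = word_eval s w.
Proof.
elim: w => [|[i b] w IH]; first by rewrite /word_eval !big_nil.
rewrite /word_eval !big_cons -/(word_eval s w) -/(word_eval gen_gen w) -IH.
by case: b.
Qed.

Lemma generates_gen_gen : generates gen_gen.
Proof.
by move=> x; have [w wE] := gen_ex x; exists w; apply: val_inj; rewrite val_word_eval_gen.
Qed.
End GeneratedSubgroup.

Definition lamp_perm (j : 'I_2) : 'S_3 :=
  if j == 0 then tperm 0 1 else tperm 1 (1 + 1).

Lemma lamp_perm_comm : (lamp_perm 0%R * lamp_perm 1%R <> lamp_perm 1%R * lamp_perm 0%R)%g.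
Proof.
move=> /(congr1 (fun s : 'S_3 => s 0)); rewrite !permM.
have -> : lamp_perm 0 = tperm 0 1 by [].
have -> : lamp_perm 1 = tperm 1 (1 + 1) by [].
by rewrite tpermL tpermL (@tpermD _ 1 (1 + 1) 0) // tpermL.
Qed.

(** * Words in shifts and lamps *)

Section LampWords.
Variables (G : groupType) (t : 'I_2 -> G).

(** Of the four generators the first two shift the position in [G], the last two switch the lamp at
    1. *)
Definition shift_letter (l : 'I_(2 + 2) * bool) : option ('I_2 * bool) :=
  if fintype.split l.1 is inl j then Some (j, l.2) else None.
Definition shift_word (w : word (2 + 2)) : word 2 := pmap shift_letter w.

Definition letter_eval (l : 'I_2 * bool) : G := if l.2 then t l.1 else (t l.1)^-1%g.

(* The value at x of the lamp component of the word w in the wreath product of 'S_3 with G. *)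
Fixpoint lamp_fun (w : word (2 + 2)) (x : G) : 'S_3 :=
  if w is l :: w' then
    match fintype.split l.1 with
    | inl j => lamp_fun w' ((letter_eval (j, l.2))^-1 * x)%g
    | inr j => ((if x == 1%g then (if l.2 then lamp_perm j else (lamp_perm j)^-1) else 1)
                * lamp_fun w' x)%g
    end
  else 1%g.

Lemma word_eval_cons l (w : word 2) : word_eval t (l :: w) = (letter_eval l * word_eval t w)%g.
Proof. by rewrite /word_eval big_cons. Qed.

(** Lamps are switched only at positions reached by the shifts in a prefix of [w]. *)
Lemma lamp_fun_supp w x : lamp_fun w x <> 1%g ->
  exists2 p : word 2, (size p <= size w)%N & x = word_eval t p.
Proof.
elim: w x => [|[i b] w IH] x //=; case: (fintype.split i) => j.
  move=> /IH[p pw xE]; exists ((j, b) :: p) => //.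
  by rewrite word_eval_cons -xE mulKVg.
case: eqP => [->|_]; first by exists [::] => //; rewrite /word_eval big_nil.
by rewrite mul1g => /IH[p pw ->]; exists p => //; exact: leqW.
Qed.
End LampWords.

Lemma size_shift_word w : (size (shift_word w) <= size w)%N.
Proof. by rewrite size_pmap count_size. Qed.

Lemma word_eval1 (G : groupType) m (s : 'I_m -> G) : word_eval s [::] = 1%g.
Proof. by rewrite /word_eval big_nil. Qed.

(** The value at the position of [p] only depends on the triviality of words of length at most
    [size w + size p]: a shift letter is absorbed into [p], a lamp letter compares the position with
    1. *)
Lemma lamp_fun_transfer (G H : groupType) (t : 'I_2 -> G) (u : 'I_2 -> H) k w p :
  same_relations k t u -> (size w + size p <= k)%N ->
  lamp_fun t w (word_eval t p) = lamp_fun u w (word_eval u p).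
Proof.
move=> tu; elim: w p => [|[i b] w IH] p //= wp; case: (fintype.split i) => j.
  have E (K : groupType) (v : 'I_2 -> K) :
      ((letter_eval v (j, b))^-1 * word_eval v p)%g = word_eval v ((j, ~~ b) :: p).
    by rewrite word_eval_cons /letter_eval; case: (b); rewrite /= ?invgK.
  by rewrite !E; apply: IH; rewrite /= addnS.
rewrite IH; last by apply: ltnW.
congr (_ * _)%g; have [h1 h2] := tu p (leq_trans (leq_addl _ _) wp).
by case: eqP => [/h1 ->|h]; [rewrite eqxx|case: eqP => // /h2].
Qed.

(** The bound [k + k] allows [k] letters for the word and [k] for the position of a switched
    lamp. *)
Lemma lamp_trivial_transfer (G H : groupType) (t : 'I_2 -> G) (u : 'I_2 -> H) k w :
  same_relations (k + k) t u -> (size w <= k)%N ->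
  word_eval t (shift_word w) = 1%g /\ (forall x, lamp_fun t w x = 1%g) ->
  word_eval u (shift_word w) = 1%g /\ (forall x, lamp_fun u w x = 1%g).
Proof.
move=> tu wk [t1 F1]; split.
  apply/tu => //; rewrite (leq_trans (size_shift_word w)) // (leq_trans wk) //.
  exact: leq_addr.
move=> x; apply: contrapT => ne; have [p pw xE] := lamp_fun_supp ne.
apply: ne; rewrite xE -(lamp_fun_transfer tu) //.
by rewrite leq_add // (leq_trans pw).
Qed.

Section LampGroup.
Variable G : groupType.

(* Unrestricted wreath product of 'S_3 with G. *)
Definition lamp : Type := (G -> 'S_3) * G.
HB.instance Definition _ := Choice.on lamp.

Definition lamp_one : lamp := (fun=> 1%g, 1%g).
Definition lamp_mul (x y : lamp) : lamp :=
  (fun z => x.1 z * y.1 (x.2^-1 * z), x.2 * y.2)%g.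
Definition lamp_inv (x : lamp) : lamp := (fun z => (x.1 (x.2 * z))^-1, x.2^-1)%g.

Lemma lamp_mulA : associative lamp_mul.
Proof.
move=> x y z; rewrite /lamp_mul /= mulgA; congr (_, _); apply/funext => u /=.
by rewrite invMg !mulgA.
Qed.
Lemma lamp_mul1 : left_id lamp_one lamp_mul.
Proof.
case=> f x; rewrite /lamp_mul /= mul1g; congr (_, _); apply/funext => u /=.
by rewrite invg1 !mul1g.
Qed.
Lemma lamp_mulr1 : right_id lamp_one lamp_mul.
Proof.
by case=> f x; rewrite /lamp_mul /= mulg1; congr (_, _); apply/funext => u; rewrite /= mulg1.
Qed.
Lemma lamp_mulV : left_inverse lamp_one lamp_inv lamp_mul.
Proof.
case=> f x; rewrite /lamp_mul /= mulVg; congr (_, _); apply/funext => u /=.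
by rewrite invgK mulVg.
Qed.
Lemma lamp_mulrV : right_inverse lamp_one lamp_inv lamp_mul.
Proof.
case=> f x; rewrite /lamp_mul /= mulgV; congr (_, _); apply/funext => u /=.
by rewrite mulKVg mulgV.
Qed.

HB.instance Definition _ := isGroup.Build lamp
  lamp_mulA lamp_mul1 lamp_mulr1 lamp_mulV lamp_mulrV.

Definition lamp_at (x : G) (s : 'S_3) : lamp := (fun z => if z == x then s else 1%g, 1%g).

(** Conjugation by a pure shift moves the lamp from 1 to [h.2], and lamps at distinct positions
    commute. *)
Lemma lamp_at_commute (h : lamp) s s' : (forall z, h.1 z = 1%g) -> h.2 <> 1%g ->
  (lamp_at 1 s * (h * lamp_at 1 s' * h^-1) = h * lamp_at 1 s' * h^-1 * lamp_at 1 s)%g.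
Proof.
case: h => F h /= F1 h1; congr (_, _); last by rewrite /= !mulg1 mul1g mulgV.
apply/funext => z; rewrite /= !F1 !invg1 !mulg1 !mul1g mulgV invg1 mul1g.
case: eqP => [->|_]; last by rewrite mul1g mulg1.
rewrite mulg1 (_ : (_ == 1%g) = false) ?mulg1 ?mul1g //.
by apply/eqP => /(congr1 (fun u => u^-1%g)); rewrite invgK invg1.
Qed.

Variable t : 'I_2 -> G.

Definition lamp_gen (i : 'I_(2 + 2)) : lamp :=
  match fintype.split i with inl j => (fun=> 1%g, t j) | inr j => lamp_at 1%g (lamp_perm j) end.

Lemma word_eval_lamp w : word_eval lamp_gen w = (lamp_fun t w, word_eval t (shift_word w)).
Proof.
elim: w => [|[i b] w IH]; first by rewrite !word_eval1.
rewrite /word_eval big_cons -/(word_eval lamp_gen w) -/(word_eval t _) IH /=.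
rewrite /shift_word /= /shift_letter /lamp_gen /=.
case: (fintype.split i) => j /=.
  rewrite word_eval_cons /letter_eval /=.
  by case: b; congr (_, _); apply/funext => z /=; rewrite ?invg1 mul1g.
case: b; congr (_, _); rewrite /= ?invg1 ?mul1g //; apply/funext => z /=; rewrite ?invg1 !mul1g //.
by case: eqP; rewrite ?invg1.
Qed.

Lemma word_eval_lamp_eq1 w : word_eval lamp_gen w = 1%g <->
  word_eval t (shift_word w) = 1%g /\ (forall x, lamp_fun t w x = 1%g).
Proof.
rewrite word_eval_lamp; split=> [[E ->]|[-> E]]; first by split=> // x; rewrite E.
by congr (_, _); apply/funext.
Qed.
End LampGroup.

Section FiniteLampGroup.
Variable G : finGroupType.

(** The same wreath product, on finite functions so as to be a finite group. *)
Definition flamp : Type := ({ffun G -> 'S_3} * G)%type.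
HB.instance Definition _ := Finite.on flamp.

Definition flamp_one : flamp := ([ffun=> 1%g], 1%g).
Definition flamp_mul (x y : flamp) : flamp :=
  ([ffun z => x.1 z * y.1 (x.2^-1 * z)], x.2 * y.2)%g.
Definition flamp_inv (x : flamp) : flamp := ([ffun z => (x.1 (x.2 * z))^-1], x.2^-1)%g.

Lemma flamp_mulA : associative flamp_mul.
Proof.
move=> x y z; rewrite /flamp_mul /= mulgA; congr (_, _); apply/ffunP => u.
by rewrite !ffunE invMg !mulgA.
Qed.
Lemma flamp_mul1 : left_id flamp_one flamp_mul.
Proof.
case=> f x; rewrite /flamp_mul /= mul1g; congr (_, _); apply/ffunP => u.
by rewrite !ffunE /= invg1 !mul1g.
Qed.
Lemma flamp_mulr1 : right_id flamp_one flamp_mul.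
Proof.
by case=> f x; rewrite /flamp_mul /= mulg1; congr (_, _); apply/ffunP => u; rewrite !ffunE mulg1.
Qed.
Lemma flamp_mulV : left_inverse flamp_one flamp_inv flamp_mul.
Proof.
case=> f x; rewrite /flamp_mul /= mulVg; congr (_, _); apply/ffunP => u.
by rewrite !ffunE /= invgK mulVg.
Qed.
Lemma flamp_mulrV : right_inverse flamp_one flamp_inv flamp_mul.
Proof.
case=> f x; rewrite /flamp_mul /= mulgV; congr (_, _); apply/ffunP => u.
by rewrite !ffunE /= mulKVg mulgV.
Qed.

HB.instance Definition _ := isGroup.Build flamp
  flamp_mulA flamp_mul1 flamp_mulr1 flamp_mulV flamp_mulrV.

Variable t : 'I_2 -> G.

Definition flamp_gen (i : 'I_(2 + 2)) : flamp :=
  match fintype.split i with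
  | inl j => ([ffun=> 1%g], t j)
  | inr j => ([ffun z => if z == 1%g then lamp_perm j else 1%g], 1%g)
  end.

Lemma word_eval_flamp w :
  word_eval flamp_gen w = (finfun (lamp_fun t w), word_eval t (shift_word w)).
Proof.
elim: w => [|[i b] w IH]; first by rewrite !word_eval1; congr (_, _); apply/ffunP => z;
  rewrite !ffunE.
rewrite /word_eval big_cons -/(word_eval flamp_gen w) -/(word_eval t _) IH /=.
rewrite /shift_word /= /shift_letter /flamp_gen /=.
case: (fintype.split i) => j /=.
  rewrite word_eval_cons /letter_eval /=.
  by case: b; congr (_, _); apply/ffunP => z; rewrite !ffunE /= ?ffunE ?invg1 mul1g.
case: b; congr (_, _); rewrite /= ?invg1 ?mul1g //; apply/ffunP => z;
  rewrite !ffunE /= ?ffunE ?invg1 !mul1g //.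
by case: eqP; rewrite ?invg1.
Qed.

Lemma word_eval_flamp_eq1 w : word_eval flamp_gen w = 1%g <->
  word_eval t (shift_word w) = 1%g /\ (forall x, lamp_fun t w x = 1%g).
Proof.
rewrite word_eval_flamp; split=> [[/ffunP E ->]|[-> E]].
  by split=> // x; have := E x; rewrite !ffunE.
by congr (_, _); apply/ffunP => x; rewrite !ffunE.
Qed.
End FiniteLampGroup.

Lemma lamp_same_relations (G : groupType) (H : finGroupType) (t : 'I_2 -> G) (u : 'I_2 -> H) k :
  same_relations (k + k) t u -> same_relations k (lamp_gen t) (flamp_gen u).
Proof.
move=> tu w wk; rewrite word_eval_lamp_eq1 word_eval_flamp_eq1.
have ut : same_relations (k + k) u t.
  by move=> v vk; have [h1 h2] := tu v vk; split.
by split; [exact: lamp_trivial_transfer tu wk|exact: lamp_trivial_transfer ut wk].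
Qed.

(** * Residual finiteness of the matrix group and the lamplighter example *)

Definition sl2_gen (R : comNzRingType) (j : 'I_2) : sl2 R :=
  if j == 0 then sl2_up 3 else sl2_rot R.

Definition map4 (R R' : Type) (f : R -> R') (x : R * R * R * R) : R' * R' * R' * R' :=
  let: (a, b, c, d) := x in (f a, f b, f c, f d).

Lemma val_word_eval_sl2 (R R' : comNzRingType) (f : {rmorphism R -> R'}) w :
  val (word_eval (sl2_gen R') w) = map4 f (val (word_eval (sl2_gen R) w)).
Proof.
have mapM x y : map4 f (mx2_mul x y) = mx2_mul (map4 f x) (map4 f y).
  by case: x y => [[[a b] c] d] [[[a' b'] c'] d'] /=; rewrite !rmorphD !rmorphM.
have gen (l : 'I_2 * bool) : val (if l.2 then sl2_gen R' l.1 else (sl2_gen R' l.1)^-1)%g =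
    map4 f (val (if l.2 then sl2_gen R l.1 else (sl2_gen R l.1)^-1)%g).
  case: l => j b /=; rewrite /sl2_gen; case: (j == 0); case: b => /=.
  - by rewrite !rmorph1 !rmorph0 rmorph_nat.
  - by rewrite !rmorphN !rmorph1 !rmorph0 rmorph_nat.
  - by rewrite !rmorphN !rmorph1 !rmorph0.
  - by rewrite !rmorphN !rmorph1 !rmorph0.
elim: w => [|l w IH]; first by rewrite !word_eval1 /= !rmorph1 !rmorph0.
rewrite /word_eval !big_cons -/(word_eval (sl2_gen R') w) -/(word_eval (sl2_gen R) w).
rewrite [LHS]/(mx2_mul _ _) IH gen; exact/esym/mapM.
Qed.

Lemma intr_Zp_eq0 n (e : int) : (`|e| < n.+2)%N -> e%:~R = 0 :> 'Z_n.+2 -> e = 0.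
Proof.
move=> en; have : (`|e|%:R == 0 :> 'Z_n.+2) = (e == 0).
  by rewrite -val_eqE /= val_Zp_nat // modn_small // absz_eq0.
rewrite [e in e%:~R]intEsign rmorphM /= rmorphXn /= rmorphN1 => E /eqP.
by rewrite mulr_sign; case: (e < 0)%R; rewrite ?oppr_eq0 E => /eqP.
Qed.

(** The modulus exceeds the entries of [x - 1] for all values [x] of words of length at most [k], so
    such an [x] congruent to 1 is 1. *)
Lemma sl2_residually_finite k :
  exists n, same_relations k (sl2_gen int) (sl2_gen 'Z_n.+2).
Proof.
pose ent (x : sl2 int) : nat := let: (a, b, c, d) := val x in (`|a - 1| + `|b| + `|c| + `|d - 1|)%N.
pose W := words_le (enum {: 'I_2 * bool}) k.
pose n := (\sum_(w <- W) ent (word_eval (sl2_gen int) w))%N.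
exists n => w wk.
have wW : w \in W by apply: mem_words_le => // l _; rewrite mem_enum.
have : (ent (word_eval (sl2_gen int) w) <= n)%N by rewrite /n (big_rem w) //= leq_addr.
have vE := val_word_eval_sl2 (intmul 1 : {rmorphism int -> 'Z_n.+2}) w.
move: (word_eval (sl2_gen int) w) vE => x vE en; split=> [x1|x1].
  by apply: val_inj; rewrite vE x1.
apply: val_inj; move: vE en; rewrite x1 /ent.
case: (val x) => [[[a b] c] d] /= e en.
have [ea eb ec ed] := @pair4_inj 'Z_n.+2 _ _ _ _ 1 0 0 1 (esym e).
have a1 : a - 1 = 0 by apply: (@intr_Zp_eq0 n); [lia|rewrite rmorphB /= ea subrr].
have d1 : d - 1 = 0 by apply: (@intr_Zp_eq0 n); [lia|rewrite rmorphB /= ed subrr].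
have b0 : b = 0 by apply: (@intr_Zp_eq0 n) => //; lia.
have c0 : c = 0 by apply: (@intr_Zp_eq0 n) => //; lia.
by rewrite b0 c0 (subr0_eq a1) (subr0_eq d1).
Qed.

Definition lamp_sl2 : groupType := generated_subgroup (lamp_gen (sl2_gen int)).

Lemma lamp_sl2_finitely_generated : finitely_generated lamp_sl2.
Proof. by exists (2 + 2)%N, (gen_gen (lamp_gen (sl2_gen int))); exact: generates_gen_gen. Qed.

Lemma lamp_sl2_locally_finite_embeddable : locally_finite_embeddable lamp_sl2.
Proof.
refine (locally_finite_embeddable_of_relations
  (@generates_gen_gen _ _ (lamp_gen (sl2_gen int))) _) => k.
have [n rel] := sl2_residually_finite (k + k).
exists (flamp (sl2 'Z_n.+2)), (flamp_gen (sl2_gen 'Z_n.+2)) => w wk.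
have h := lamp_same_relations rel wk; split=> [h1|/h h1].
  by apply/h; rewrite -val_word_eval_gen h1.
by apply: val_inj; rewrite val_word_eval_gen.
Qed.

(** * Failure of residual amenability *)

Section NotResiduallyAmenable.
Variable R : realType.

Let g (i : 'I_(2 + 2)) : lamp_sl2 := gen_gen (lamp_gen (sl2_gen int)) i.
Let c0 := g (rshift 2 0).
Let c1 := g (rshift 2 1).

Let val_c j : val (g (rshift 2 j)) = lamp_at 1%g (lamp_perm j).
Proof. by rewrite /g /= /lamp_gen (unsplitK (inr j)). Qed.

Let val_t j : val (g (lshift 2 j)) = (fun=> 1%g, sl2_gen int j).
Proof. by rewrite /g /= /lamp_gen (unsplitK (inl j)). Qed.

Let valM (x y : lamp_sl2) : val (x * y)%g = lamp_mul (val x) (val y).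
Proof. by []. Qed.

Let valV (x : lamp_sl2) : val (x^-1)%g = lamp_inv (val x).
Proof. by []. Qed.

(** An amenable quotient [Q] keeping the commutator of the two lamps is injective on the shifts [L].
    Representatives of the [L]-orbits in [Q] then yield an equivariant map from [Q] to the plane,
    contradicting [not_amenable_plane]. *)
Lemma lamp_sl2_not_residually_amenable : ~ residually_amenable R lamp_sl2.
Proof.
move=> ra.
have ne : ((c0 * c1) * (c1 * c0)^-1)%g <> 1%g :> lamp_sl2.
  move=> /(congr1 (fun y => y * (c1 * c0))%g); rewrite mulgKV mul1g.
  move=> /(congr1 (fun x => (val x).1 1%g)).
  rewrite !valM !val_c /=; exact: lamp_perm_comm.
have [Q [f [amQ fsurj fne]]] := ra _ ne.
have fM x y : f (x * y)%g = (f x * f y)%g by exact: gmulfM.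
have f1 : f 1%g = 1%g by apply: (mulgI (f 1%g)); rewrite -fM !mulg1.
have fV x : f x^-1%g = (f x)^-1%g by apply: (mulgI (f x)); rewrite -fM !mulgV f1.
(* If [f x = 1], the lamp [c1] and its conjugate by [x] have the same image; when [x] shifts
   nontrivially the conjugate commutes with [c0], so the commutator dies. *)
have inj (x : lamp_sl2) : (forall z, (val x).1 z = 1%g) -> f x = 1%g -> (val x).2 = 1%g.
  move=> x1 fx; apply: contrapT => xne; apply: fne.
  have com : (c0 * (x * c1 * x^-1) = (x * c1 * x^-1) * c0)%g.
    by apply: val_inj; rewrite !(valM, valV) !val_c; exact: lamp_at_commute.
  have := congr1 f com; rewrite !fM fV fx invg1 mulg1 mul1g => com'.
  by rewrite fV fM com' mulgV.
pose L (x : lamp_sl2) := forall z, (val x).1 z = 1%g.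
pose orb (q : Q) : set Q := [set q' | exists2 x, L x & q' = (f x * q)%g]%classic.
have LM x y : L x -> L y -> L (x * y)%g by move=> Lx Ly z; rewrite valM /= Lx Ly mulg1.
have LV x : L x -> L (x^-1)%g by move=> Lx z; rewrite valV /= Lx invg1.
have orb_eq x q : L x -> orb (f x * q)%g = orb q.
  move=> Lx; apply/seteqP; split=> q' [y Ly ->].
    by exists (y * x)%g; [exact: LM|rewrite fM mulgA].
  by exists (y * x^-1)%g; [exact: LM (LV _ Lx)|rewrite fM fV mulgA mulgKV].
have orb_id q : orb q q by exists 1%g; rewrite // f1 mul1g.
pose rep q := xget 1%g (orb q).
have lift_ex q : exists x, L x /\ q = (f x * rep q)%g.
  have [x Lx rE] : orb q (rep q) by apply: xgetPex; exists q.
  by exists (x^-1)%g; split; [exact: LV|rewrite rE fV mulKg].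
have [y yE] := choice lift_ex.
(* Although [y] is merely chosen, its matrix part is determined by the orbit representative, by
   injectivity on shifts. *)
have y_eq x q : L x -> (val (y (f x * q)%g)).2 = ((val x).2 * (val (y q)).2)%g.
  move=> Lx; have [Ly qE] := yE q; have [Ly' qE'] := yE (f x * q)%g.
  have rE : rep (f x * q)%g = rep q by rewrite /rep orb_eq.
  have /(mulIg _) fE : (f (y (f x * q)%g) * rep q = f (x * y q)%g * rep q)%g.
    by rewrite fM -mulgA -qE -{1}rE -qE'.
  have := inj (y (f x * q)%g * (x * y q)^-1)%g (LM _ _ Ly' (LV _ (LM _ _ Lx Ly))).
  rewrite fM fV fE mulgV => /(_ erefl) /= h.
  by rewrite -[LHS](mulgKV ((val x).2 * (val (y q)).2)%g) h mul1g.
pose plane (q : Q) : int * int := let v := val (val (y q)).2 in (v.1.1.1, v.1.2).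
apply: (@not_amenable_plane R int Q plane (f (g (lshift 2 0))) (f (g (lshift 2 1)))) => //.
- move=> q; rewrite /plane; case: ((val (y q)).2) => [[[[a b] c] d] /= h] [a0 c0'].
  by move: h; rewrite a0 c0' mul0r mulr0 subrr eq_sym oner_eq0.
- move=> q; exists false; rewrite /plane y_eq; last by move=> z; rewrite val_t.
  rewrite val_t /=; case: ((val (y q)).2) => [[[[a b] c] d] h] /=.
  by rewrite !mul1r mul0r add0r.
- move=> q; exists false; rewrite /plane y_eq; last by move=> z; rewrite val_t.
  rewrite val_t /=; case: ((val (y q)).2) => [[[[a b] c] d] h] /=.
  by rewrite !mul1r !mul0r add0r addr0 mulN1r.
Qed.
End NotResiduallyAmenable.

Theorem corollary6p6 (R : realType) :
  (forall G : groupType, lef_group R G -> determinant_conjecture R G) /\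
  (exists G : groupType,
     [/\ countable [set: G]%classic, ~ amenable R G, simple_group G &
         determinant_conjecture R G]) /\
  (exists G : groupType,
     [/\ finitely_generated G, ~ residually_amenable R G &
         determinant_conjecture R G]).
Proof.
split; first by move=> G /lef_group_locally_finite_embeddable/determinant_conjecture_lfe.
split.
  exists (psl2 rat); split.
  - exact: psl2_rat_countable.
  - exact: psl2_rat_not_amenable.
  (* In [rat], [2 ^+ 4 = 16] differs from 1. *)
  - exact: (@psl2_simple _ 2%R).
  - exact: determinant_conjecture_lfe psl2_rat_locally_finite_embeddable.
exists lamp_sl2; split.
- exact: lamp_sl2_finitely_generated.
- exact: lamp_sl2_not_residually_amenable.
- exact: determinant_conjecture_lfe lamp_sl2_locally_finite_embeddable.
Qed.
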